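(* Let $(\Gamma,\psi)$ be a model of $T_{\log}$. Then the subset $\Psi=\psi(\Gamma\setminus\{0\})$ of $\Gamma$ is stably embedded in $(\Gamma,\psi)$.
   Context: Stably embedded: a $0$-definable subset $P$ of the underlying set of a structure $\mathcal{M}$ is stably embedded in $\mathcal{M}$ if for every $n\ge1$, every subset of $P^n$ that is definable in $\mathcal{M}$ with parameters from $\mathcal{M}$ is definable in $\mathcal{M}$ with parameters from $P$. Asymptotic couples. An asymptotic couple is a pair $(\Gamma,\psi)$ where $\Gamma$ is a (totally) ordered abelian group and $\psi:\Gamma^{\neq}\to\Gamma$ (with $\Gamma^{\neq}=\Gamma\setminus\{0\}$) satisfies for all $\alpha,\beta\in\Gamma^{\neq}$: (AC1) $\alpha+\beta\neq0\Rightarrow\psi(\alpha+\beta)\geq\min(\psi(\alpha),\psi(\beta))$; (AC2) $\psi(r\alpha)=\psi(\alpha)$ for all nonzero $r\in\mathbb{Z}$; (AC3) $\alpha>0\Rightarrow\alpha+\psi(\alpha)>\psi(\beta)$. It is $H$-asymptotic (of $H$-type) if moreover $0<\alpha\leq\beta\Rightarrow\psi(\alpha)\geq\psi(\beta)$, and divisible if $\Gamma$ is divisible. Put $\Psi=\psi(\Gamma^{\neq})$ and $\gamma'=\gamma+\psi(\gamma)$ for $\gamma\in\Gamma^{\neq}$. $(\Gamma,\psi)$ has asymptotic integration if $\{\gamma':\gamma\in\Gamma^{\neq}\}=\Gamma$; if it is also of $H$-type, then for each $\alpha\in\Gamma$ there is a unique $\beta\in\Gamma^{\neq}$ with $\beta'=\alpha$,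 denoted $\int\alpha$, and the successor function is $s:\Gamma\to\Psi$, $s(\alpha)=\psi(\int\alpha)$; write $s\alpha=s(\alpha)$, so $s0=s(0)$. The theory $T_{\log}$. Let $L_0=\{0,+,-,<,\psi,\infty\}$. An asymptotic couple is an $L_0$-structure with underlying set $\Gamma_\infty=\Gamma\cup\{\infty\}$, $\Gamma<\infty$, and $\infty$ as default value: $-\infty=\gamma+\infty=\infty+\gamma=\infty+\infty=\psi(0)=\psi(\infty)=\infty$. $T_0$ is the $L_0$-theory whose models are the divisible $H$-asymptotic couples with asymptotic integration such that: $\Psi$ has a least element, equal to $s0$, and $s0>0$; every $\alpha\in\Psi$ has an immediate successor in the ordered set $\Psi$, namely $s\alpha$; and $\gamma\mapsto s\gamma:\Psi\to\Psi^{>s0}=\{x\in\Psi:x>s0\}$ is a bijection. For a model of $T_0$ let $p:\Psi^{>s0}\to\Psi$ be the inverse of this bijection, extended to $\Gamma_\infty$ by $p(\alpha)=\infty$ for $\alpha\in\Gamma_\infty\setminus\Psi^{>s0}$. Let $L=L_0\cup\{s,p,\delta_1,\delta_2,\dots\}$ with all new symbols unary function symbols; models of $T_0$ are construed as $L$-structures with $s$ interpreted as the successor function $\alpha\mapsto\psi(\int\alpha)$ on $\Gamma$ and $s(\infty)=\infty$, $p$ interpreted as the function $p:\Gamma_\infty\to\Gamma_\infty$ that inverts $\gamma\mapsto s\gamma:\Psi\to\Psi^{>s0}$ on $\Psi^{>s0}$ and takes the value $\infty$ elsewhere, and $\delta_n$ interpreted as division by $n$ ($\delta_n(\infty)=\infty$).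 $T_{\log}$ is the $L$-theory whose models are the models of $T_0$ so construed. *)

(* Defs.v *)
From mathcomp Require Import all_boot all_order all_algebra.
From mathcomp Require Import boolp classical_sets functions.

Set Implicit Arguments.
Unset Strict Implicit.
Unset Printing Implicit Defensive.

Import Order.TTheory GRing.Theory Num.Theory.
Local Open Scope classical_set_scope.
Local Open Scope ring_scope.

(** * First-order logic and stable embeddedness *)

Record language := Language {
  func_sym : Type;
  func_arity : func_sym -> nat;
  rel_sym : Type;
  rel_arity : rel_sym -> nat
}.

Record structure (L : language) := Structure {
  carrier :> Type;
  func_interp : forall f : func_sym L, ('I_(func_arity f) -> carrier) -> carrier;
  rel_interp : forall r : rel_sym L, ('I_(rel_arity r) -> carrier) -> Prop
}.

(* Terms and formulas whose free variables are indexed by 'I_n. *)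
Inductive term (L : language) (n : nat) : Type :=
| Var of 'I_n
| App (f : func_sym L) of ('I_(func_arity f) -> term L n).

(* Under a quantifier variable 0 is the bound one, and the free variable i
   of the context becomes variable i.+1.  Satisfaction is classical, so Not,
   And and Ex express every connective and quantifier. *)
Inductive formula (L : language) : nat -> Type :=
| Equal n of term L n & term L n : formula L n
| Rel n (r : rel_sym L) of ('I_(rel_arity r) -> term L n) : formula L n
| Not n of formula L n : formula L n
| And n of formula L n & formula L n : formula L n
| Ex n of formula L n.+1 : formula L n.

Fixpoint eval (L : language) (M : structure L) (n : nat) (e : 'I_n -> M)
    (t : term L n) : M :=
  match t with
  | Var i => e i
  | App f ts => @func_interp L M f (fun j => eval e (ts j))
  end.

Definition env_cons (T : Type) (n : nat) (x : T) (e : 'I_n -> T) :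
    'I_n.+1 -> T :=
  fun i => if unlift ord0 i is Some j then e j else x.

Definition env_cat (T : Type) (m n : nat) (x : 'I_m -> T) (y : 'I_n -> T) :
    'I_(m + n) -> T :=
  fun i => match fintype.split i with inl j => x j | inr k => y k end.

Fixpoint holds (L : language) (M : structure L) (n : nat) (phi : formula L n) :
    ('I_n -> M) -> Prop :=
  match phi in formula _ k return ('I_k -> M) -> Prop with
  | Equal _ t u => fun e => eval e t = eval e u
  | Rel _ r ts => fun e => @rel_interp L M r (fun j => eval e (ts j))
  | Not _ phi1 => fun e => ~ holds phi1 e
  | And _ phi1 phi2 => fun e => holds phi1 e /\ holds phi2 e
  | Ex _ phi1 => fun e => exists x : M, holds phi1 (env_cons x e)
  end.

Definition definable_over (L : language) (M : structure L) (A : set M)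
    (n : nat) (X : set ('I_n -> M)) : Prop :=
  exists (m : nat) (phi : formula L (n + m)) (c : 'I_m -> M),
    (forall k, A (c k)) /\ forall x, X x <-> holds phi (env_cat x c).

Definition stably_embedded (L : language) (M : structure L) (P : set M) :
    Prop :=
  definable_over set0 [set x : 'I_1 -> M | P (x ord0)] /\
  forall (n : nat) (X : set ('I_n -> M)), (0 < n)%N ->
    (forall x, X x -> forall i, P (x i)) ->
    definable_over setT X -> definable_over P X.

(** * Ordered abelian groups *)

(* porderZmodType does not relate the order to the addition. *)
Record ordered_group (G : porderZmodType) : Prop := {
  og_total : forall a b : G, (a <= b) || (b <= a);
  og_lerD2r : forall c a b : G, a <= b -> a + c <= b + c
}.

(** * Asymptotic couples *)

Section AsymptoticCouples.
Variables (G : porderZmodType) (psi : G -> G).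
(* The value psi 0 is junk: nothing below depends on it for models of T0. *)

Record asymptotic_couple : Prop := {
  AC_group : ordered_group G;
  AC1 : forall a b : G, a != 0 -> b != 0 -> a + b != 0 ->
    Order.min (psi a) (psi b) <= psi (a + b);
  AC2 : forall (r : int) (a : G), r != 0 -> a != 0 -> psi (a *~ r) = psi a;
  AC3 : forall a b : G, a != 0 -> b != 0 -> 0 < a -> psi b < a + psi a
}.

Definition H_type : Prop :=
  forall a b : G, 0 < a -> a <= b -> psi b <= psi a.

Definition divisible : Prop :=
  forall (n : nat) (a : G), (0 < n)%N -> exists b : G, b *+ n = a.

Definition Psi : set G := psi @` [set g | g != 0].

Definition ac_deriv (g : G) : G := g + psi g.

Definition asymptotic_integration : Prop :=
  ac_deriv @` [set g | g != 0] = setT.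

Definition ac_integral (a : G) : G := xget 0 [set b | b != 0 /\ ac_deriv b = a].

Definition ac_succ (a : G) : G := psi (ac_integral a).

Definition Psi_gt_s0 : set G := [set x | Psi x /\ ac_succ 0 < x].

Definition immediate_successor (A : set G) (a b : G) : Prop :=
  [/\ A b, a < b & forall c, A c -> a < c -> b <= c].

Record T0_model : Prop := {
  T0_couple : asymptotic_couple;
  T0_H_type : H_type;
  T0_divisible : divisible;
  T0_integration : asymptotic_integration;
  T0_s0_in : Psi (ac_succ 0);
  T0_s0_least : forall a, Psi a -> ac_succ 0 <= a;
  T0_s0_gt0 : 0 < ac_succ 0;
  T0_successor : forall a, Psi a -> immediate_successor Psi a (ac_succ a);
  T0_bij : set_bij Psi Psi_gt_s0 ac_succ
}.

(** * The language L and models of T0 as L-structures *)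

(* The carrier is option G, with None as infinity. *)

Definition add_inf (x y : option G) : option G :=
  if x is Some a then if y is Some b then Some (a + b) else None else None.

Definition opp_inf (x : option G) : option G := omap -%R x.

Definition psi_inf (x : option G) : option G :=
  if x is Some a then if a == 0 then None else Some (psi a) else None.

Definition lt_inf (x y : option G) : Prop :=
  match x, y with
  | Some a, Some b => a < b
  | Some _, None => True
  | None, _ => False
  end.

Definition succ_inf (x : option G) : option G := omap ac_succ x.

Definition pred_inf (x : option G) : option G :=
  xget None [set y | exists a b,
    [/\ x = Some a, Psi_gt_s0 a, y = Some b, Psi b & ac_succ b = a]].

Definition div_inf (n : nat) (x : option G) : option G :=
  omap (fun a => xget 0 [set b : G | b *+ n = a]) x.

End AsymptoticCouples.

(* FDiv n stands for delta_(n.+1), so that exactly the delta_n with n >= 1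
   are in the language. *)
Inductive log_func :=
| FZero | FAdd | FOpp | FPsi | FInfty | FSucc | FPred | FDiv of nat.

Definition log_func_arity (f : log_func) : nat :=
  match f with FZero | FInfty => 0 | FAdd => 2 | _ => 1 end.

Inductive log_rel := RLt.

Definition log_language : language :=
  Language log_func_arity (fun _ : log_rel => 2%N).

Definition Tlog_structure (G : porderZmodType) (psi : G -> G) :
    structure log_language :=
  @Structure log_language (option G)
    (fun f => match f return
         ('I_(log_func_arity f) -> option G) -> option G with
       | FZero => fun _ => Some 0
       | FAdd => fun x => add_inf (x ord0) (x ord_max)
       | FOpp => fun x => opp_inf (x ord0)
       | FPsi => fun x => psi_inf psi (x ord0)
       | FInfty => fun _ => None
       | FSucc => fun x => succ_inf psi (x ord0)
       | FPred => fun x => pred_inf psi (x ord0)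
       | FDiv n => fun x => div_inf n.+1 (x ord0)
       end)
    (fun _ x => lt_inf (x ord0) (x ord_max)).

Definition Psi_inf (G : porderZmodType) (psi : G -> G) :
    set (Tlog_structure psi) := Some @` Psi psi.
Arguments Psi_inf {G} psi.

(* Main.v *)
Require Import Defs.
From HB Require Import structures.
From mathcomp Require Import all_boot all_order all_algebra.
From mathcomp Require Import boolp classical_sets functions.
From mathcomp Require Import ring lra.

(* Read psi as a convex valuation on the ordered Q-vector space Gamma, with
   psi 0 = infinity, and let omega be a pseudolimit of Psi, so that
   psi (omega - a) = s a for all a in Gamma.  With lam x the predecessor of x
   in Psi (lam s0 = 0, lam infinity = omega) one has psi (lam y - lam x) = x
   for x < y.  A system of conditions psi (y - a_i) = x_i together with the
   signs of the y - a_i is solvable in y if and only if it is pairwise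
   consistent, since the quotients {psi >= x} / {psi > x} are divisible, hence
   dense, ordered groups without endpoints.  Moreover psi (b + q lam x), as a
   function of x, is u := psi (b + q omega) for u < x, is x for x < u, and at
   x = u it is psi (b + q lam u).  Together these two facts eliminate the
   quantifiers over Gamma: every formula in g becomes a decision tree that
   successively computes finitely many valuations and signs of linear forms in
   g, in omega and in lam of the values already found, with first-order formulas
   over the pure order Psi at its leaves; variables ranging over Psi occur at
   the leaves only.  Fixing the parameters in Gamma fixes the values along one
   branch, and these values serve as the parameters in Psi. *)

Set Implicit Arguments.
Unset Strict Implicit.
Unset Printing Implicit Defensive.

Import Order.TTheory GRing.Theory Num.Theory.
Local Open Scope ring_scope.

(** * Environments over arbitrary index types *)

Definition ocons (T I : Type) (x : T) (e : I -> T) : option I -> T :=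
  fun i => if i is Some j then e j else x.

Definition senv (T A B : Type) (a : A -> T) (b : B -> T) : A + B -> T :=
  fun i => match i with inl j => a j | inr k => b k end.

Definition smap (A B C D : Type) (f : A -> C) (h : B -> D) (i : A + B) : C + D :=
  match i with inl j => inl (f j) | inr k => inr (h k) end.

(** * Definable predicates over a linear order *)

Section OrderDefinable.
Variables (T : Type) (lt : T -> T -> Prop).

(** Definability is a property of predicates on environments rather than of syntax, so closure
    properties need only hold up to equivalence. Equality is not primitive: over a strict total
    order it says that neither side is below the other. *)
Inductive odef : forall I : Type, ((I -> T) -> Prop) -> Prop :=
| odef_lt I (i j : I) : odef (fun e => lt (e i) (e j))
| odef_not I (P : (I -> T) -> Prop) : odef P -> odef (fun e => ~ P e)
| odef_and I (P Q : (I -> T) -> Prop) :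
    odef P -> odef Q -> odef (fun e => P e /\ Q e)
| odef_ex I (P : (option I -> T) -> Prop) :
    odef P -> odef (fun e : I -> T => exists x, P (ocons x e)).

Lemma odef_ext I (P Q : (I -> T) -> Prop) :
  (forall e, P e <-> Q e) -> odef P -> odef Q.
Proof. by move=> PQ; suff -> : P = Q by []; apply/funext => e; apply/propext. Qed.

Lemma odef_sub I (P : (I -> T) -> Prop) J (f : I -> J) :
  odef P -> odef (fun e => P (fun i => e (f i))).
Proof.
move=> oP; elim: oP J f => {I P}.
- by move=> I i j J f; apply: (odef_lt (f i) (f j)).
- by move=> I P _ IH J f; apply: odef_not.
- by move=> I P Q _ IHP _ IHQ J f; apply: odef_and.
- move=> I P _ IH J f; apply: (odef_ext _ (odef_ex (IH _ (omap f)))) => e.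
  by split=> -[x Px]; exists x; congr P: Px; apply/funext => -[].
Qed.

Lemma odef_or I (P Q : (I -> T) -> Prop) :
  odef P -> odef Q -> odef (fun e => P e \/ Q e).
Proof.
move=> oP oQ.
apply: (odef_ext _ (odef_not (odef_and (odef_not oP) (odef_not oQ)))) => e.
by have [] := EM (P e); have [] := EM (Q e); tauto.
Qed.

Lemma odef_const I (A : Prop) : odef (fun _ : I -> T => A).
Proof.
(* There is no truth constant; truth is obtained as excluded middle for the sentence that some [x]
   satisfies [lt x x]. *)
have oE : odef (fun e : I -> T => exists x, lt x x).
  by apply: (odef_ex (@odef_lt (option I) None None)).
have oT : odef (fun _ : I -> T => True).
  by apply: (odef_ext _ (odef_or oE (odef_not oE))) => e; split=> // _; exact: EM.
have [a|a] := EM A.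
  by apply: odef_ext oT => e; tauto.
by apply: (odef_ext _ (odef_not oT)) => e; tauto.
Qed.

End OrderDefinable.

(** * Linear forms *)

Definition form (X : Type) := seq (rat * X).

Section Forms.
Variable V : lmodType rat.

Definition lev (X : Type) (e : X -> V) (t : form X) : V :=
  \sum_(c <- t) c.1 *: e c.2.

Definition fscale (X : Type) (q : rat) (t : form X) : form X :=
  [seq (q * c.1, c.2) | c <- t].

Definition fsubst (X Y : Type) (s : X -> form Y) (t : form X) : form Y :=
  flatten [seq fscale c.1 (s c.2) | c <- t].

Lemma lev_nil X (e : X -> V) : lev e [::] = 0.
Proof. by rewrite /lev big_nil. Qed.

Lemma lev_var X (e : X -> V) x : lev e [:: (1, x)] = e x.
Proof. by rewrite /lev big_seq1 scale1r. Qed.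

Lemma lev_cons X (e : X -> V) c t : lev e (c :: t) = c.1 *: e c.2 + lev e t.
Proof. by rewrite /lev big_cons. Qed.

Lemma lev_cat X (e : X -> V) t u : lev e (t ++ u) = lev e t + lev e u.
Proof. by rewrite /lev big_cat. Qed.

Lemma lev_scale X (e : X -> V) q t : lev e (fscale q t) = q *: lev e t.
Proof.
rewrite /lev big_map scaler_sumr; apply: eq_bigr => c _ /=.
by rewrite scalerA.
Qed.

Lemma lev_subst X Y (e : Y -> V) (s : X -> form Y) t :
  lev e (fsubst s t) = lev (fun x => lev e (s x)) t.
Proof.
elim: t => [|c t IH]; first by rewrite !lev_nil.
by rewrite /fsubst /= lev_cat lev_scale lev_cons -IH.
Qed.

(** All variables that [d] sends to [None] take the value of one unknown [y], and [q] collects their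
    coefficients. Both [q] and [b] are independent of the environment, so a tree can be built by
    cases on [q]. *)
Lemma lev_split Y Z (d : Y -> option Z) t : exists q b, forall (e : Z -> V) y,
  lev (fun x => oapp e y (d x)) t = q *: y + lev e b.
Proof.
elim: t => [|[c x] t [q [b IH]]].
  by exists 0, [::] => e y; rewrite !lev_nil scale0r add0r.
case dx : (d x) => [z|].
  exists q, ((c, z) :: b) => e y.
  by rewrite !lev_cons IH dx /= addrCA.
exists (c + q), b => e y.
by rewrite lev_cons IH dx /= scalerDl addrA.
Qed.

End Forms.

(** * Ordered vector spaces with a convex valuation and a pseudo-Cauchy family *)

(* pos is the positive cone of V and lam top is a pseudolimit of the family lam,
   lying outside the dense subspace em W. *)
Record cut_space (W V : lmodType rat) (em : {linear W -> V})
    (pos : V -> Prop) (T : Type) (lt : T -> T -> Prop) (top : T)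
    (val : V -> T) (lam : T -> V) : Prop := {
  cs_lt_irr : forall x, ~ lt x x;
  cs_lt_trans : forall x y z, lt x y -> lt y z -> lt x z;
  cs_lt_total : forall x y, [\/ lt x y, x = y | lt y x];
  cs_lt_top : forall x, ~ lt top x;
  pos0 : ~ pos 0;
  posD : forall a b, pos a -> pos b -> pos (a + b);
  posZ : forall q a, 0 < q -> pos a -> pos (q *: a);
  pos_total : forall a, a != 0 -> pos a \/ pos (- a);
  val_top : forall a, val a = top <-> a = 0;
  valZ : forall q a, q != 0 -> val (q *: a) = val a;
  valD : forall a b x, ~ lt (val a) x -> ~ lt (val b) x -> ~ lt (val (a + b)) x;
  val_convex : forall a b, pos a -> pos b -> ~ lt (val a) (val (a + b));
  val_surj : forall x, x <> top -> exists a, val a = x;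
  em_dense : forall b x, x <> top -> exists a : W, lt x (val (em a - b));
  val_lam : forall x y, lt x y -> val (lam y - lam x) = x;
  pos_lam : forall x y, lt x y -> pos (lam y - lam x);
  lam_em : forall x, x <> top -> exists a, em a = lam x;
  em_top : forall a c, em a = c *: lam top -> c = 0
}.

(** Serves to choose a condition with the largest value, the greatest centre below the unknown and,
    with the order reversed, the least centre above it. *)
Lemma exists_greatest (A : Type) (R : A -> A -> Prop) (S : A -> Prop)
    (L : seq A) :
    (forall a, R a a) -> (forall a b, S a -> S b -> R a b \/ R b a) ->
    (forall a b c, S a -> S b -> S c -> R a b -> R b c -> R a c) ->
  (exists2 a, List.In a L & S a) ->
  exists2 m, List.In m L /\ S m & forall a, List.In a L -> S a -> R a m.
Proof.
move=> Rr Rt Rtr; elim: L => [|a L IH] [b] //=.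
have [[c cL Sc]|nL] := EM (exists2 a, List.In a L & S a).
  have [m [mL Sm] mmax] := IH (ex_intro2 _ _ c cL Sc).
  have [Sa|nSa] := EM (S a); last first.
    by move=> _ _; exists m; [tauto|move=> d [<- //|]; exact: mmax].
  have [am|ma] := Rt a m Sa Sm.
    by move=> _ _; exists m; [tauto|move=> d [<- //|]; exact: mmax].
  move=> _ _; exists a; [tauto|move=> d [<- _|dL Sd]]; first exact: Rr.
  by apply: (Rtr d m a) => //; exact: mmax.
move=> [<- Sa|bL Sb]; last by case: nL; exists b.
exists a; [tauto|move=> d [<- _|dL Sd]]; first exact: Rr.
by case: nL; exists d.
Qed.

Section CutSpace.
Variables (W V : lmodType rat) (em : {linear W -> V}).
Variables (pos : V -> Prop) (T : Type) (lt : T -> T -> Prop) (top : T).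
Variables (val : V -> T) (lam : T -> V).
Hypothesis H : cut_space em pos lt top val lam.

(** * Values and signs of sums and multiples *)

Lemma cs_lt_asym x y : lt x y -> ~ lt y x.
Proof. by move=> xy yx; exact: (cs_lt_irr H (cs_lt_trans H xy yx)). Qed.

Lemma lt_ntrans x y z : lt x y -> ~ lt z y -> lt x z.
Proof.
move=> xy zy; have [yz|<-//|//] := cs_lt_total H y z.
exact: (cs_lt_trans H xy yz).
Qed.

Lemma lt_nlt_eq x y : ~ lt x y -> ~ lt y x -> x = y.
Proof. by have [] := cs_lt_total H x y. Qed.

Lemma lt_neq_top x y : lt x y -> x <> top.
Proof. by move=> xy xt; apply: (cs_lt_top H (x := y)); rewrite -xt. Qed.

Lemma val0 : val 0 = top.
Proof. exact/(val_top H). Qed.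

Lemma valN a : val (- a) = val a.
Proof. by rewrite -scaleN1r (valZ H) // oppr_eq0 oner_eq0. Qed.

Lemma valB a b : val (a - b) = val (b - a).
Proof. by rewrite -valN opprB. Qed.

Lemma valD_lt a b x : lt x (val a) -> lt x (val b) -> lt x (val (a + b)).
Proof.
move=> xa xb; have [ab|nab] := EM (lt (val a) (val b)).
  apply: (lt_ntrans xa); apply: (valD H); first exact: (cs_lt_irr H).
  exact: cs_lt_asym.
by apply: (lt_ntrans xb); apply: (valD H) => //; exact: (cs_lt_irr H).
Qed.

(** If [a + b] had a value above [val a], then so would [a = (a + b) - b]. *)
Lemma val_dom a b : lt (val a) (val b) -> val (a + b) = val a.
Proof.
move=> ab; apply: lt_nlt_eq.
  by apply: (valD H); [exact: (cs_lt_irr H)|exact: cs_lt_asym].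
move=> aab; have := @valD_lt (a + b) (- b) (val a) aab.
by rewrite valN addrK => /(_ ab); exact: (cs_lt_irr H).
Qed.

Lemma pos_asym a : pos a -> ~ pos (- a).
Proof. by move=> pa /(posD H pa); rewrite subrr; exact: (pos0 H). Qed.

Lemma pos_opp a : a != 0 -> pos (- a) <-> ~ pos a.
Proof.
move=> a0; split; first by move=> pN pa; exact: (pos_asym pa).
by have [] := pos_total H a0.
Qed.

Lemma val_neq_top a : val a <> top -> a != 0.
Proof. by move=> h; apply/eqP => a0; apply: h; exact/(val_top H). Qed.

(** If [- (a + b)] were positive, then [a] and [- (a + b)] would be positive with sum [- b], whose
    value lies above [val a], against convexity. *)
Lemma posD_dom a b : lt (val a) (val b) -> pos a -> pos (a + b).
Proof.
move=> ab pa; apply: contrapT => nab.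
have /(pos_total H)[//|pN] : a + b != 0.
  by apply: val_neq_top; rewrite val_dom //; exact: lt_neq_top ab.
apply: (val_convex H pa pN); rewrite opprD addrA subrr add0r valN //.
Qed.

Lemma pos_dom a b : lt (val a) (val b) -> pos (a + b) <-> pos a.
Proof.
move=> ab; split; last exact: posD_dom.
move=> pab; rewrite -(addrK b a); apply: posD_dom pab.
by rewrite val_dom // valN.
Qed.

Lemma posZ_neg q a : q < 0 -> pos (q *: a) <-> pos (- a).
Proof.
move=> q0; split=> p.
  have : pos ((- q^-1) *: (q *: a)) by apply: (posZ H) p; rewrite oppr_gt0 invr_lt0.
  by rewrite scalerA mulNr mulVf ?lt_eqF // scaleN1r.
by rewrite -(opprK q) scaleNr -scalerN; apply: (posZ H) p; rewrite oppr_gt0.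
Qed.

Lemma posZ_pos q a : 0 < q -> pos (q *: a) <-> pos a.
Proof.
move=> q0; split=> p; last exact: (posZ H).
have : pos (q^-1 *: (q *: a)) by apply: (posZ H) p; rewrite invr_gt0.
by rewrite scalerA mulVf ?gt_eqF // scale1r.
Qed.

Lemma exists_pos_val x : x <> top -> exists2 z, pos z & val z = x.
Proof.
move=> xt; have [z zx] := val_surj H xt.
have /(pos_total H)[pz|pz] : z != 0 by apply: val_neq_top; rewrite zx.
  by exists z.
by exists (- z); rewrite ?valN.
Qed.

(** * Solvability of valuation and sign conditions in one unknown *)

(** One possible outcome of a probe at [y - a]. The sign [false] means negative or zero, and zero
    occurs exactly when [x] is [top]. *)
Definition cond (y a : V) (x : T) (s : bool) : Prop :=
  val (y - a) = x /\ (pos (y - a) <-> s).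

(** Value [top] forces the unknown to be the centre [a] itself, which must then come from [W] and
    leaves no positive sign. *)
Definition cond_top (a : V) (x : T) (s : bool) : Prop :=
  x = top -> (exists y, em y = a) /\ ~ s.

(** A condition with the larger value confines the unknown so closely to its centre [a] that the
    other condition is already decided at [a]. For equal values both centres lie in one closed ball;
    if the unknown has to lie above [a] and below [b], the gap [b - a] needs value exactly [x], so
    that there is room in between. *)
Definition compatible (a : V) (x : T) (s : bool) (b : V) (y : T) (r : bool) :
    Prop :=
  (lt y x -> val (a - b) = y /\ (pos (a - b) <-> r)) /\
  (x = y -> ~ lt (val (a - b)) x /\
    (x <> top -> s -> ~ r -> pos (b - a) /\ val (b - a) = x)).

Lemma cond_close y z a x s : lt x (val (z - y)) -> cond y a x s -> cond z a x s.
Proof.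
move=> xz [yx ys]; rewrite /cond.
have -> : z - a = (y - a) + (z - y) by rewrite [RHS]addrC addrA subrK.
have d : lt (val (y - a)) (val (z - y)) by rewrite yx.
by rewrite val_dom //; split=> //; exact: (iff_trans (pos_dom d) ys).
Qed.

Lemma cond_compatible y a x s b t r :
  cond y a x s -> cond y b t r -> compatible a x s b t r.
Proof.
move=> [ya sa] [yb rb].
have E : a - b = (y - b) + - (y - a) by rewrite opprB [RHS]addrC addrA subrK.
split=> [tx|xt].
  have d : lt (val (y - b)) (val (- (y - a))) by rewrite valN ya yb.
  by rewrite E val_dom //; split=> //; exact: (iff_trans (pos_dom d) rb).
split.
  rewrite E -ya; apply: (valD H); first by rewrite yb ya xt; exact: (cs_lt_irr H).
  by rewrite valN; exact: (cs_lt_irr H).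
move=> xtop hs hr.
have pa : pos (y - a) by apply/sa.
have pb : pos (b - y).
  rewrite -opprB; apply/pos_opp; last by move/rb.
  by apply: val_neq_top; rewrite yb -xt.
have Eb : b - a = (y - a) + (b - y) by rewrite [RHS]addrC addrA subrK.
split; first by rewrite Eb; exact: (posD H).
apply: lt_nlt_eq.
  rewrite Eb; apply: (valD H); first by rewrite ya; exact: (cs_lt_irr H).
  by rewrite valB yb xt; exact: (cs_lt_irr H).
by rewrite Eb -{1}ya; exact: (val_convex H).
Qed.

(** The difference of the midpoint and [a] is half of [u - l], of value [x], plus [l - a], which is
    positive or zero; convexity keeps the value of the sum from rising above [x]. *)
Lemma cond_between a x (l u : V) : pos (u - l) -> val (u - l) = x ->
  pos (l - a) \/ l = a -> ~ lt (val (l - a)) x ->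
  cond (2^-1 *: (l + u)) a x true.
Proof.
move=> plu vlu pla vla.
have ph : pos (2^-1 *: (u - l)) by apply: (posZ H).
have vh : val (2^-1 *: (u - l)) = x by rewrite (valZ H).
have -> : 2^-1 *: (l + u) = l + 2^-1 *: (u - l).
  rewrite scalerDr scalerBr addrCA; rewrite [in LHS]addrC; congr (_ + _).
  apply/eqP; rewrite eq_sym subr_eq -scalerDl.
  by rewrite (_ : 2^-1 + 2^-1 = 1 :> rat) ?scale1r //; lra.
rewrite /cond addrAC [l - a + _]addrC.
have pp : pos (2^-1 *: (u - l) + (l - a)).
  by case: pla => [pla|<-]; [exact: (posD H)|rewrite subrr addr0].
split; last by split.
apply: lt_nlt_eq.
  by apply: (valD H) => //; rewrite vh; exact: (cs_lt_irr H).
rewrite -{1}vh; case: pla => [pla|<-].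
  exact: (val_convex H).
by rewrite subrr addr0; exact: (cs_lt_irr H).
Qed.

(** Negation exchanges the two ends and reduces this to [cond_between]. *)
Lemma cond_between_opp a x (l u : V) : pos (u - l) -> val (u - l) = x ->
  pos (a - u) \/ u = a -> ~ lt (val (u - a)) x ->
  cond (2^-1 *: (l + u)) a x false.
Proof.
move=> plu vlu pau vau.
have E : 2^-1 *: (- u + - l) - - a = - (2^-1 *: (l + u) - a).
  by rewrite -opprD scalerN -opprD [u + l]addrC.
have [] := @cond_between (- a) x (- u) (- l).
- by rewrite opprK addrC.
- by rewrite opprK addrC.
- by case: pau => [p|->]; [left; rewrite opprK addrC|right].
- by rewrite -opprD valN.
rewrite E valN => vx px; split=> //; split=> // p.
by case: (pos_asym p); exact/px.
Qed.

(** A condition [m] with the largest value governs the others. If that value is [top], the unknown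
    is the centre [a m]. Otherwise only the conditions of that same value remain to be met, and a
    midpoint between the centres below and the centres above meets them; density then moves it into
    [W]. *)
Lemma exists_cond (A : Type) (L : seq A) (a : A -> V) (x : A -> T)
    (s : A -> bool) :
  (exists y : W, forall i, List.In i L -> cond (em y) (a i) (x i) (s i)) <->
  (forall i, List.In i L -> cond_top (a i) (x i) (s i)) /\
  (forall i, List.In i L -> forall j, List.In j L ->
     compatible (a i) (x i) (s i) (a j) (x j) (s j)).
Proof.
split=> [[y yL]|[Ltop Lc]].
  split=> [i iL|i iL j jL]; last exact: (cond_compatible (yL i iL) (yL j jL)).
  move=> xt; have [vx px] := yL i iL.
  have /eqP : em y - a i = 0 by apply/(val_top H); rewrite vx.
  rewrite subr_eq0 => /eqP ey; split; first by exists y.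
  by move/px; rewrite ey subrr; exact: (pos0 H).
have [[i0 i0L]|nL] := EM (exists i, List.In i L); last first.
  by exists 0 => i iL; case: nL; exists i.
have [m [mL _] mmax] : exists2 m, List.In m L /\ True &
    forall i, List.In i L -> True -> ~ lt (x m) (x i).
  apply: exists_greatest; last by exists i0.
  - by move=> i; exact: (cs_lt_irr H).
  - move=> i j _ _; have [h|->|h] := cs_lt_total H (x i) (x j).
    + by left; exact: cs_lt_asym.
    + by left; exact: (cs_lt_irr H).
    + by right; exact: cs_lt_asym.
  - by move=> i j k _ _ _ ji kj ki; exact: (kj (lt_ntrans ki ji)).
(* Conditions with smaller values hold on the whole closed ball of value [x m] around [a m], because
   [a m] satisfies them. *)
have below y i : List.In i L -> lt (x i) (x m) -> ~ lt (val (y - a m)) (x m) ->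
    cond y (a i) (x i) (s i).
  move=> iL im ym; have [/(_ im)[vx px] _] := Lc m mL i iL.
  apply: (@cond_close (a m)); last by [].
  exact: lt_ntrans im ym.
have [xt|xnt] := EM (x m = top).
  have [[y ya] ns] := Ltop m mL xt; exists y => i iL.
  have [im|im|mi] := cs_lt_total H (x i) (x m).
  - by apply: below => //; rewrite ya subrr val0 xt; exact: (cs_lt_irr H).
  - have [_ /(_ (esym im))[nv _]] := Lc m mL i iL.
    have [_ nsi] := Ltop i iL (etrans im xt).
    have /eqP : a m - a i = 0.
      apply/(val_top H); apply: lt_nlt_eq; last exact: (cs_lt_top H).
      by rewrite -xt.
    rewrite subr_eq0 => /eqP ami; rewrite /cond ya ami subrr val0 im xt.
    by split=> //; split=> // /(pos0 H).
  - by case: (mmax i).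
(* It suffices to solve the conditions of the largest value in [V]: density gives an element of [W]
   so near that no condition changes. *)
suff [y yL] : exists y, forall i, List.In i L -> x i = x m ->
    cond y (a i) (x i) (s i).
  have [w wy] := em_dense H y xnt; exists w => i iL.
  have [im|im|mi] := cs_lt_total H (x i) (x m); last by case: (mmax i).
    apply: (cond_close (y := y)).
      exact: (cs_lt_trans H im).
    apply: below => //.
    have [vy _] := yL m mL erefl.
    by rewrite vy; exact: (cs_lt_irr H).
  by apply: (cond_close (y := y)); [rewrite im|exact: yL].
pose S b i := x i = x m /\ s i = b.
pose le i j := pos (a j - a i) \/ a i = a j.
have le_total i j : le i j \/ le j i.
  have [E|/eqP ne] := EM (a i = a j); first by left; right.
  have /(pos_total H)[p|p] : a i - a j != 0 by rewrite subr_eq0.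
    by right; left.
  by left; left; rewrite -opprB.
have le_tr i j k : le i j -> le j k -> le i k.
  move=> [pij|Eij] [pjk|Ejk]; last by right; rewrite Eij.
  - left; have -> : a k - a i = (a j - a i) + (a k - a j).
      by rewrite [RHS]addrC addrA subrK.
    exact: (posD H).
  - by left; rewrite -Ejk.
  - by left; rewrite Eij.
have le_r i : le i i by right.
have close i j : List.In i L -> List.In j L -> x i = x m -> x j = x m ->
    ~ lt (val (a i - a j)) (x m).
  move=> iL jL im jm.
  have [_ E] := Lc i iL j jL; rewrite -im.
  by have [] := E (etrans im (esym jm)).
have gap i j : List.In i L -> List.In j L -> S true i -> S false j ->
    pos (a j - a i) /\ val (a j - a i) = x m.
  move=> iL jL [im si] [jm sj]; have [_ E] := Lc i iL j jL.
  have [_] := E (etrans im (esym jm)); rewrite im si sj; exact.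
have [z pz vz] := exists_pos_val xnt.
(* The bounds are the greatest centre that must lie below the unknown and the least that must lie
   above. A missing bound is placed at distance [z] from the other; if both are missing, [0] and [z]
   serve. *)
have [l [u [plu vlu hl hu]]] : exists l u, [/\ pos (u - l), val (u - l) = x m,
   (forall i, List.In i L -> S true i ->
      (pos (l - a i) \/ l = a i) /\ ~ lt (val (l - a i)) (x m)) &
   (forall i, List.In i L -> S false i ->
      (pos (a i - u) \/ u = a i) /\ ~ lt (val (u - a i)) (x m))].
  have [eT|nT] := EM (exists2 i, List.In i L & S true i).
    have [l [lL Sl] lmax] := @exists_greatest _ le (S true) L le_r
      (fun i j _ _ => le_total i j) (fun i j k _ _ _ => @le_tr i j k) eT.
    have hl i : List.In i L -> S true i -> (pos (a l - a i) \/ a l = a i) /\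
        ~ lt (val (a l - a i)) (x m).
      move=> iL Si; split; first by case: (lmax i iL Si); [left|right].
      by apply: close => //; [case: Sl|case: Si].
    have [eF|nF] := EM (exists2 i, List.In i L & S false i).
      have [u [uL Su] umin] := @exists_greatest _ (fun i j => le j i) (S false)
        L le_r (fun i j _ _ => le_total j i)
        (fun i j k _ _ _ ji kj => @le_tr k j i kj ji) eF.
      have [plu vlu] := gap l u lL uL Sl Su.
      exists (a l), (a u); split=> // i iL Si; split.
        by case: (umin i iL Si); [left|right].
      by apply: close => //; [case: Su|case: Si].
    exists (a l), (a l + z); rewrite addrC addKr; split=> // i iL Si.
    by case: nF; exists i.
  have [eF|nF] := EM (exists2 i, List.In i L & S false i).
    have [u [uL Su] umin] := @exists_greatest _ (fun i j => le j i) (S false)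
      L le_r (fun i j _ _ => le_total j i)
      (fun i j k _ _ _ ji kj => @le_tr k j i kj ji) eF.
    exists (a u - z), (a u); rewrite subKr; split=> // i iL Si.
      by case: nT; exists i.
    split; first by case: (umin i iL Si); [left|right].
    by apply: close => //; [case: Su|case: Si].
  exists 0, z; rewrite subr0; split=> // i iL Si.
    by case: nT; exists i.
  by case: nF; exists i.
exists (2^-1 *: (l + u)) => i iL im; rewrite im.
case si : (s i).
  by have [h1 h2] := hl i iL (conj im si); exact: cond_between.
by have [h1 h2] := hu i iL (conj im si); exact: cond_between_opp.
Qed.

End CutSpace.

(** * Decision trees of values and signs *)

Section NormalForm.
Variables (W V : lmodType rat) (em : {linear W -> V}).
Variables (pos : V -> Prop) (T : Type) (lt : T -> T -> Prop) (top : T).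
Variables (val : V -> T) (lam : T -> V).
Hypothesis H : cut_space em pos lt top val lam.

(** [inr None] denotes the pseudolimit [lam top], and [inr (Some j)] denotes [lam] of the computed
    value [w j]. *)
Definition venv (K J : Type) (g : K -> W) (w : J -> T) : K + option J -> V :=
  senv (fun k => em (g k)) (fun j => lam (ocons top w j)).

(* g lists the elements of W, w the values computed by the probes so far and v
   the variables ranging over T, which no linear form involves. *)
Inductive nf (K I : Type) :
    forall J : Type, ((K -> W) -> (J -> T) -> (I -> T) -> Prop) -> Prop :=
| nf_leaf J (P : (J + I -> T) -> Prop) : odef lt P ->
    nf (fun (g : K -> W) (w : J -> T) (v : I -> T) => P (senv w v))
| nf_probe J (t : form (K + option J)) P Q :
    @nf K I (option J) P -> @nf K I (option J) Q ->
    nf (fun (g : K -> W) (w : J -> T) (v : I -> T) =>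
          let b := lev (venv g w) t in
          (pos b /\ P g (ocons (val b) w) v) \/
          (~ pos b /\ Q g (ocons (val b) w) v)).

Lemma nf_ext K I J (P Q : (K -> W) -> (J -> T) -> (I -> T) -> Prop) :
  (forall g w v, P g w v <-> Q g w v) -> nf P -> nf Q.
Proof.
move=> PQ; suff -> : P = Q by [].
by apply/funext => g; apply/funext => w; apply/funext => v; apply/propext.
Qed.

(** Vectors are replaced by linear forms, which may take values outside the image of [em]. Hence [Q]
    is only claimed to agree with [P] at environments where each form equals some [em (g k)]. *)
Lemma nf_subst K I J (P : (K -> W) -> (J -> T) -> (I -> T) -> Prop) :
  nf P -> forall K' I' J' (s : K -> form (K' + option J')) (f : J -> J')
    (h : I -> I'),
  exists2 Q, nf Q & forall (g : K -> W) (g' : K' -> W) (w : J' -> T)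
      (v : I' -> T), (forall k, em (g k) = lev (venv g' w) (s k)) ->
    P g (fun j => w (f j)) (fun i => v (h i)) <-> Q g' w v.
Proof.
elim=> {J P} [J P oP|J t P Q _ IHP _ IHQ] K' I' J' s f h.
  eexists; first exact: (nf_leaf _ (odef_sub (smap f h) oP)).
  move=> g g' w v _ /=.
  by have -> : senv (fun j => w (f j)) (fun i => v (h i)) =
     (fun i => senv w v (smap f h i)) by apply/funext => -[].
pose s' k : form (K' + option (option J')) :=
  fsubst (fun x => [:: (1, smap id (omap Some) x)]) (s k).
have [P' nP' PP'] := IHP K' I' (option J') s' (omap f) h.
have [Q' nQ' QQ'] := IHQ K' I' (option J') s' (omap f) h.
pose st (x : K + option J) : form (K' + option J') :=
  match x with inl k => s k | inr o => [:: (1, inr (omap f o))] end.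
eexists; first exact: (nf_probe (fsubst st t) nP' nQ').
move=> g g' w v sg /=.
have -> : lev (venv g' w) (fsubst st t) = lev (venv g (fun j => w (f j))) t.
  rewrite lev_subst; congr lev; apply/funext => -[k|[j|]] /=.
  - by rewrite sg.
  - by rewrite lev_var.
  - by rewrite lev_var.
set b := lev _ t.
have -> : ocons (val b) (fun j => w (f j)) =
    (fun j => ocons (val b) w (omap f j)) by apply/funext => -[].
have sg' k : em (g k) = lev (venv g' (ocons (val b) w)) (s' k).
  rewrite sg /s' lev_subst; congr lev.
  by apply/funext => -[k'|[j|]]; rewrite lev_var.
have := PP' g g' (ocons (val b) w) v sg'.
have := QQ' g g' (ocons (val b) w) v sg'.
by tauto.
Qed.

Lemma nf_rename K I J K' I' J' (a : K -> K') (f : J -> J') (h : I -> I')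
    (P : (K -> W) -> (J -> T) -> (I -> T) -> Prop) : nf P ->
  nf (fun g w v => P (fun k => g (a k)) (fun j => w (f j)) (fun i => v (h i))).
Proof.
move=> nP; have [Q nQ PQ] := nf_subst nP (fun k => [:: (1, inl (a k))]) f h.
apply: nf_ext nQ => g w v; apply: iff_sym; apply: PQ => k.
by rewrite lev_var.
Qed.

Lemma nf_wren K I J J' (f : J -> J')
    (P : (K -> W) -> (J -> T) -> (I -> T) -> Prop) : nf P ->
  nf (fun g w v => P g (fun j => w (f j)) v).
Proof. exact: (@nf_rename K I J K I J' id f id P). Qed.

Lemma nf_const K I J (A : Prop) : nf (fun (_ : K -> W) (_ : J -> T) (_ : I -> T) => A).
Proof. exact: (nf_leaf _ (odef_const lt _ A)). Qed.

(** Exactly one branch of each probe is taken, so negation passes to the leaves. *)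
Lemma nf_not K I J (P : (K -> W) -> (J -> T) -> (I -> T) -> Prop) :
  nf P -> nf (fun g w v => ~ P g w v).
Proof.
elim=> {J P} [J P oP|J t P Q _ IHP _ IHQ].
  exact: (nf_leaf _ (odef_not oP)).
apply: (nf_ext _ (nf_probe t IHP IHQ)) => g w v /=.
by have [] := EM (pos (lev (venv g w) t)); tauto.
Qed.

(** The second tree is grafted onto the leaves of the first. *)
Lemma nf_and K I J (P Q : (K -> W) -> (J -> T) -> (I -> T) -> Prop) :
  nf P -> nf Q -> nf (fun g w v => P g w v /\ Q g w v).
Proof.
move=> nP; elim: nP Q => {J P} [J P oP|J t P P' _ IHP _ IHP'] Q nQ.
  elim: nQ P oP => {J Q} [J Q oQ|J t Q Q' _ IHQ _ IHQ'] P oP.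
    exact: (nf_leaf _ (odef_and oP oQ)).
  pose P1 (e : option J + I -> T) := P (fun i => e (smap Some id i)).
  have oP1 : odef lt P1 := odef_sub _ oP.
  apply: (nf_ext _ (nf_probe t (IHQ _ oP1) (IHQ' _ oP1))) => g w v /=.
  have E x : P1 (senv (ocons x w) v) = P (senv w v).
    by congr P; apply/funext => -[].
  by rewrite !E; tauto.
have nQ1 := nf_wren (@Some J) nQ.
apply: (nf_ext _ (nf_probe t (IHP _ nQ1) (IHP' _ nQ1))) => g w v /=.
by tauto.
Qed.

Lemma nf_or K I J (P Q : (K -> W) -> (J -> T) -> (I -> T) -> Prop) :
  nf P -> nf Q -> nf (fun g w v => P g w v \/ Q g w v).
Proof.
move=> nP nQ; apply: (nf_ext _ (nf_not (nf_and (nf_not nP) (nf_not nQ)))).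
move=> g w v; have [] := EM (P g w v); have [] := EM (Q g w v); tauto.
Qed.

Lemma nf_imp K I J (P Q : (K -> W) -> (J -> T) -> (I -> T) -> Prop) :
  nf P -> nf Q -> nf (fun g w v => P g w v -> Q g w v).
Proof.
move=> nP nQ; apply: (nf_ext _ (nf_or (nf_not nP) nQ)).
by move=> g w v; have [] := EM (P g w v); tauto.
Qed.

Lemma nf_iff K I J (P Q : (K -> W) -> (J -> T) -> (I -> T) -> Prop) :
  nf P -> nf Q -> nf (fun g w v => P g w v <-> Q g w v).
Proof. by move=> nP nQ; apply: nf_and; apply: nf_imp. Qed.

Lemma nf_allIn K I J (A : Type)
    (F : A -> (K -> W) -> (J -> T) -> (I -> T) -> Prop) (L : seq A) :
  (forall c, nf (F c)) ->
  nf (fun g w v => forall c, List.In c L -> F c g w v).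
Proof.
move=> nF; elim: L => [|c L IH].
  by apply: (nf_ext _ (nf_const K I J True)).
apply: (nf_ext _ (nf_and (nF c) IH)) => g w v; split.
  by move=> [Fc FL] d /= [<-|/FL].
by move=> FL; split=> [|d dL]; apply: FL; [left|right].
Qed.

Lemma nf_lt K I J (i j : J + I) :
  nf (fun (g : K -> W) w v => lt (senv w v i) (senv w v j)).
Proof. exact: (nf_leaf _ (odef_lt lt i j)). Qed.

Lemma nf_eq K I J (i j : J + I) :
  nf (fun (g : K -> W) w v => senv w v i = senv w v j).
Proof.
apply: (nf_ext _ (nf_and (nf_not (nf_lt K i j)) (nf_not (nf_lt K j i)))) => g w v.
by split=> [[h1 h2]|->]; [exact: (lt_nlt_eq H)|split; exact: (cs_lt_irr H)].
Qed.

Lemma nf_pos K I J (t : form (K + option J)) :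
  nf (fun g w (v : I -> T) => pos (lev (venv g w) t)).
Proof.
apply: (nf_ext _ (nf_probe t (nf_const K I _ True) (nf_const K I _ False))).
by move=> g w v /=; tauto.
Qed.

Lemma nf_val K I J (t : form (K + option J))
    (P : (K -> W) -> (option J -> T) -> (I -> T) -> Prop) : nf P ->
  nf (fun g w v => P g (ocons (val (lev (venv g w) t)) w) v).
Proof.
move=> nP; apply: (nf_ext _ (nf_probe t nP nP)) => g w v /=.
by have [] := EM (pos (lev (venv g w) t)); tauto.
Qed.

(** * Quantifiers over values *)

Lemma nf_exI K I J (P : (K -> W) -> (J -> T) -> (option I -> T) -> Prop) :
  nf P -> nf (fun g w v => exists x, P g w (ocons x v)).
Proof.
elim=> {J P} [J P oP|J t P Q _ IHP _ IHQ].
  pose r (i : J + option I) : option (J + I) :=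
    match i with inl j => Some (inl j) | inr o => omap inr o end.
  apply: (nf_ext _ (nf_leaf _ (odef_ex (odef_sub r oP)))) => g w v.
  have E x : (fun i => ocons x (senv w v) (r i)) = senv w (ocons x v).
    by apply/funext => -[j|[i|]].
  by split=> -[x hx]; exists x; rewrite ?E // -E.
(* No probe reads [v], so the quantifier passes into both branches. *)
apply: (nf_ext _ (nf_probe t IHP IHQ)) => g w v /=; split.
  by move=> [[p [x Px]]|[p [x Qx]]]; exists x; tauto.
by move=> [x [[p Px]|[p Qx]]]; [left|right]; split=> //; exists x.
Qed.

Lemma val_lam_top x : val (lam top - lam x) = x.
Proof.
have [xt|->|tx] := cs_lt_total H x top; last by case: (cs_lt_top H tx).
  exact: (val_lam H).
by rewrite subrr (val0 H).
Qed.

(* With u the value at the pseudolimit, the value of b + q * lam x is u if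
   u < x, is x if x < u, and depends on u only if x = u. *)
Lemma val_pos_lam b q x : q != 0 -> let u := val (b + q *: lam top) in
  (lt u x -> val (b + q *: lam x) = u /\
     (pos (b + q *: lam x) <-> pos (b + q *: lam top))) /\
  (lt x u -> val (b + q *: lam x) = x /\ (pos (b + q *: lam x) <-> q < 0)).
Proof.
move=> q0 u.
have vq : val ((- q) *: (lam top - lam x)) = x.
  by rewrite (valZ H) ?oppr_eq0 // val_lam_top.
have E : b + q *: lam x = (b + q *: lam top) + (- q) *: (lam top - lam x).
  by rewrite scaleNr scalerBr opprB addrACA subrr addr0.
split=> [ux|xu].
  have d : lt (val (b + q *: lam top)) (val ((- q) *: (lam top - lam x))).
    by rewrite vq.
  by rewrite E (val_dom H d); split=> //; exact: (pos_dom H d).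
have d : lt (val ((- q) *: (lam top - lam x))) (val (b + q *: lam top)).
  by rewrite vq.
rewrite E addrC (val_dom H d) vq; split=> //.
apply: (iff_trans (pos_dom H d)).
have xt : lt x top.
  have [//|xt|tx] := cs_lt_total H x top; last by case: (cs_lt_top H tx).
  by case: (cs_lt_top H (x := u)); rewrite -xt.
have pl := pos_lam H xt.
have [q_lt|q_ge] := boolP (q < 0).
  by split=> // _; apply: (posZ H) pl; rewrite oppr_gt0.
split=> //; have q_gt : - q < 0 by rewrite oppr_lt0 lt_neqAle eq_sym q0 leNgt.
by move/(posZ_neg H _ q_gt) => /(pos_asym H pl).
Qed.

(** The values [j] with [r j = None] all become the single leaf variable [v None]. A probe that
    involved them has the form [b + q * lam x] with [x] now out of its reach. By [val_pos_lam] it is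
    replaced by probes at [lam top] and at [lam u], with [u] the result of the first, followed by a
    comparison of [x] and [u] at the leaves. *)
Lemma nf_demote K I J' (Q : (K -> W) -> (J' -> T) -> (I -> T) -> Prop) :
  nf Q -> forall J (r : J' -> option J),
  nf (fun (g : K -> W) (w : J -> T) (v : option I -> T) =>
        Q g (fun j => oapp w (v None) (r j)) (fun i => v (Some i))).
Proof.
elim=> {J' Q} [J' P oP|J' t P Q _ IHP _ IHQ] J r.
  pose s (i : J' + I) : J + option I :=
    match i with
    | inl j => if r j is Some j' then inl j' else inr None
    | inr i' => inr (Some i')
    end.
  apply: (nf_ext _ (nf_leaf _ (odef_sub s oP))) => g w v.
  have -> : (fun i => senv w v (s i)) =
      senv (fun j => oapp w (v None) (r j)) (fun i => v (Some i)).
    by apply/funext => -[j|i] //=; case: (r j).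
  by [].
pose d (x : K + option J') : option (K + option J) :=
  match x with
  | inl k => Some (inl k)
  | inr None => Some (inr None)
  | inr (Some j) => omap (fun j' => inr (Some j')) (r j)
  end.
have [q [b tE]] := lev_split V d t.
have tE' g w x : lev (venv g (fun j => oapp w x (r j))) t =
    q *: lam x + lev (venv g w) b.
  rewrite -tE; congr lev; apply/funext => -[k|[j|]] //=.
  by case: (r j).
have [q0|q0] := eqVneq q 0.
  pose r' (j : option J') : option (option J) :=
    if j is Some j' then omap Some (r j') else Some None.
  apply: (nf_ext _ (nf_probe b (IHP _ r') (IHQ _ r'))) => g w v /=.
  rewrite tE' q0 scale0r add0r.
  have -> // : (fun j => oapp (ocons (val (lev (venv g w) b)) w) (v None) (r' j)) =
     ocons (val (lev (venv g w) b)) (fun j => oapp w (v None) (r j)).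
  by apply/funext => -[j|] //=; case: (r j).
(* [c] reads [lam top] in place of [lam x]; [c'] reads [lam] of the value just found by [c]. *)
pose c : form (K + option J) := (q, inr None) :: b.
pose c' : form (K + option (option J)) := (q, inr (Some None)) ::
  fsubst (fun x => [:: (1, smap id (omap Some) x)]) b.
pose J2 := option (option J).
(* These maps say where the value of the original probe is found: [ru] takes the result of [c],
   [ru'] the result of [c'], and [rx] the demoted variable itself. *)
pose old j := omap (fun j' => Some (Some j')) (r j) : option J2.
pose ru (j : option J') := if j is Some j' then old j' else Some (Some None).
pose ru' (j : option J') := if j is Some j' then old j' else Some None.
pose rx (j : option J') := if j is Some j' then old j' else None.
have np := nf_wren (fun j => Some (Some j)) (nf_pos (option I) c).
have np' := nf_wren (@Some (option J)) (nf_pos (option I) c').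
pose u : J2 + option I := inl (Some None).
pose x : J2 + option I := inr None.
(* The three cases are [u < x], [x < u] and [x = u]; the sign is that of [c], that of [- q] and that
   of [c'] respectively. *)
have n1 := nf_and (nf_lt K u x) (nf_or (nf_and np (IHP _ ru))
  (nf_and (nf_not np) (IHQ _ ru))).
have n2 := nf_and (nf_lt K x u) (nf_or (nf_and (nf_const K _ _ (q < 0)) (IHP _ rx))
  (nf_and (nf_const K _ _ (~ q < 0)) (IHQ _ rx))).
have n3 := nf_and (nf_eq K x u) (nf_or (nf_and np' (IHP _ ru'))
  (nf_and (nf_not np') (IHQ _ ru'))).
apply: (nf_ext _ (nf_val c (nf_val c' (nf_or n1 (nf_or n2 n3))))) => g w v /=.
set w1 := ocons (val (lev (venv g w) c)) w.
have cE : lev (venv g w) c = lev (venv g w) b + q *: lam top.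
  by rewrite lev_cons addrC.
have cE' : lev (venv g w1) c' = lev (venv g w) b + q *: lam (val (lev (venv g w) c)).
  rewrite lev_cons addrC lev_subst; congr (lev _ b + _).
  by apply/funext => -[k|[j|]]; rewrite lev_var.
set w2 := ocons (val (lev (venv g w1) c')) w1.
set y := v None; rewrite tE' addrC.
have oldE z (j : option J') : (oapp w2 y (if j is Some j' then old j' else z)) =
   ocons (oapp w2 y z) (fun j => oapp w y (r j)) j.
  by case: j => //= j; rewrite /old; case: (r j).
have -> : (fun j => oapp w2 y (ru j)) =
    ocons (val (lev (venv g w) c)) (fun j => oapp w y (r j)).
  by apply/funext => j; rewrite /ru oldE.
have -> : (fun j => oapp w2 y (ru' j)) =
    ocons (val (lev (venv g w1) c')) (fun j => oapp w y (r j)).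
  by apply/funext => j; rewrite /ru' oldE.
have -> : (fun j => oapp w2 y (rx j)) = ocons y (fun j => oapp w y (r j)).
  by apply/funext => j; rewrite /rx oldE.
have -> : (fun j => w2 (Some j)) = w1 by [].
have -> : (fun j => w2 (Some (Some j))) = w by [].
rewrite cE' cE.
have [lt1 lt2] := val_pos_lam (lev (venv g w) b) y q0.
set b0 := lev _ b in lt1 lt2 *; set u0 := val _ in lt1 lt2 *.
have [uy|uy|yu] := cs_lt_total H u0 y.
- have [-> sE] := lt1 uy.
  have := @cs_lt_irr _ _ _ _ _ _ _ _ _ H; have := cs_lt_asym H uy.
  move=> nyu irr; have ne : y <> u0 by move=> E; apply: (irr y); rewrite {1}E.
  by tauto.
- rewrite uy; have irr := @cs_lt_irr _ _ _ _ _ _ _ _ _ H y.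
  by tauto.
- have [-> sE] := lt2 yu.
  have := @cs_lt_irr _ _ _ _ _ _ _ _ _ H; have := cs_lt_asym H yu.
  move=> nyu irr; have ne : y <> u0 by move=> E; apply: (irr y); rewrite {2}E.
  by tauto.
Qed.

(** Once the bound value is demoted to a leaf variable, its quantifier is absorbed by the leaves. *)
Lemma nf_exJ K I J (P : (K -> W) -> (option J -> T) -> (I -> T) -> Prop) :
  nf P -> nf (fun g w v => exists x, P g (ocons x w) v).
Proof.
move=> nP; apply: (nf_ext _ (nf_exI (nf_demote nP id))) => g w v.
have E x : (fun j : option J => oapp w x j) = ocons x w by apply/funext => -[].
by split=> -[x]; exists x; rewrite ?E // -E.
Qed.

(** Demotion is iterated along [s]; after each round the fresh leaf variable is renamed to
    [inr j]. *)
Lemma nf_demote_seq K I (J : eqType) (s : seq J)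
    (Q : (K -> W) -> (J -> T) -> (I -> T) -> Prop) : nf Q ->
  nf (fun g w (v : I + J -> T) =>
    Q g (fun j => if j \in s then v (inr j) else w j) (fun i => v (inl i))).
Proof.
elim: s I Q => [|j s IH] I Q nQ.
  exact: (nf_rename id id inl nQ).
have := IH _ _ (nf_demote nQ (fun j' => if j' == j then None else Some j')).
pose h (i : option I + J) : I + J :=
  match i with inl None => inr j | inl (Some i') => inl i' | inr j' => inr j' end.
move/(nf_rename id id h); apply: nf_ext => g w v /=.
have -> // : (fun j' => oapp (fun j0 => if j0 \in s then v (inr j0) else w j0)
   (v (inr j)) (if j' == j then None else Some j')) =
   (fun j' => if j' \in j :: s then v (inr j') else w j').
by apply/funext => j'; rewrite in_cons; case: eqP => [->|].
Qed.

(* Once g is fixed every probe has a value, so the tree reduces to one leaf. *)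
Lemma nf_params K I J (P : (K -> W) -> (J -> T) -> (I -> T) -> Prop) :
  nf P -> forall g w m (f : J -> 'I_m) (c : 'I_m -> T), (forall j, w j = c (f j)) ->
  exists m' (c' : 'I_m' -> T) (R : ('I_m' + I -> T) -> Prop),
    odef lt R /\ forall v, P g w v <-> R (senv c' v).
Proof.
elim=> {J P} [J P oP|J t P Q _ IHP _ IHQ] g w m f c wc.
  exists m, c; eexists; split; first exact: (odef_sub (smap f id) oP).
  move=> v; have -> // : (fun i => senv c v (smap f id i)) = senv w v.
  by apply/funext => -[j|i] //=; rewrite wc.
set b := lev (venv g w) t.
pose f' (j : option J) : 'I_m.+1 := if j is Some j' then lift ord0 (f j') else ord0.
pose c' : 'I_m.+1 -> T := env_cons (val b) c.
have wc' j : ocons (val b) w j = c' (f' j).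
  case: j => [j|]; rewrite /c' /env_cons /f'; first by rewrite liftK /= wc.
  by rewrite unlift_none.
have [p|np] := EM (pos b).
  have [m' [c2 [R [oR RE]]]] := IHP g _ _ f' c' wc'.
  by exists m', c2, R; split=> // v /=; rewrite -/b -(propext (RE v)); tauto.
have [m' [c2 [R [oR RE]]]] := IHQ g _ _ f' c' wc'.
by exists m', c2, R; split=> // v /=; rewrite -/b -(propext (RE v)); tauto.
Qed.

(** * Quantifiers over vectors *)

Lemma senv_ocons J I (y : T) (w : J -> T) (v : I -> T) (j : J + I) :
  senv (ocons y w) v (smap Some id j) = senv w v j.
Proof. by case: j. Qed.

Lemma nf_valE K I J (t : form (K + option J)) (j : J + I) :
  nf (fun g w v => val (lev (venv g w) t) = senv w v j).
Proof.
apply: (nf_ext _ (nf_val t (nf_eq K (inl None) (smap Some id j)))) => g w v.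
by rewrite senv_ocons.
Qed.

Lemma nf_val_lt K I J (t : form (K + option J)) (j : J + I) :
  nf (fun g w v => lt (val (lev (venv g w) t)) (senv w v j)).
Proof.
apply: (nf_ext _ (nf_val t (nf_lt K (inl None) (smap Some id j)))) => g w v.
by rewrite senv_ocons.
Qed.

Lemma nf_eq_top K I J (j : J + I) :
  nf (fun (g : K -> W) w v => senv w v j = top).
Proof.
(* The order has no constant for [top]; a probe of the empty form, which evaluates to 0, supplies
   it. *)
apply: (nf_ext _ (nf_val [::] (nf_eq K (smap Some id j) (inl None)))) => g w v /=.
by rewrite lev_nil (val0 H) senv_ocons.
Qed.

Lemma nf_zero K I J (t : form (K + option J)) :
  nf (fun g w (v : I -> T) => lev (venv g w) t = 0).
Proof.
apply: (nf_ext _ (nf_val t (@nf_eq_top K I (option J) (inl None)))) => g w v /=.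
exact: (val_top H).
Qed.

(** A form takes its value in the image of [em] exactly when its total coefficient of the
    pseudolimit vanishes. Here [lam (w j)] contributes to that coefficient if and only if [w j] is
    [top], hence the case distinction; [c] accumulates the coefficient. *)
Lemma nf_in_em K I J (t : form (K + option J)) :
  nf (fun g w (v : I -> T) => exists a, em a = lev (venv g w) t).
Proof.
suff nc : forall c : rat, nf (fun g w (v : I -> T) =>
    exists a, em a = c *: lam top + lev (venv g w) t).
  by apply: (nf_ext _ (nc 0)) => g w v; rewrite scale0r add0r.
elim: t => [|[q [k|[j|]]] t IH] c.
- apply: (nf_ext _ (nf_const K I J (c = 0))) => g w v; rewrite lev_nil addr0.
  split=> [->|[a]]; last exact: (em_top H).
  by exists 0; rewrite linear0 scale0r.
- apply: (nf_ext _ (IH c)) => g w v; rewrite lev_cons /=.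
  split=> -[a aE]; [exists (q *: g k + a)|exists (a - q *: g k)].
    by rewrite linearD linearZ /= aE addrCA.
  by rewrite linearB linearZ /= aE addrCA addrAC subrr add0r.
- apply: (nf_ext _ (nf_or
    (nf_and (@nf_eq_top K I J (inl j)) (IH (c + q)))
    (nf_and (nf_not (@nf_eq_top K I J (inl j))) (IH c)))) => g w v.
  rewrite lev_cons /=; have [wt|wnt] := EM (w j = top).
    rewrite wt scalerDl addrA; tauto.
  have [y yE] := lam_em H wnt.
  suff : (exists a, em a = c *: lam top + lev (venv g w) t) <->
    (exists a, em a = c *: lam top + (q *: lam (w j) + lev (venv g w) t)) by tauto.
  split=> -[a aE]; [exists (q *: y + a)|exists (a - q *: y)].
    by rewrite linearD linearZ /= aE yE addrCA.
  by rewrite linearB linearZ /= aE yE addrCA addrAC subrr add0r.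
- apply: (nf_ext _ (IH (c + q))) => g w v; rewrite lev_cons /=.
  by rewrite scalerDl addrA.
Qed.

Definition fweaken K J (t : form (K + option J)) : form (K + option (option J)) :=
  fsubst (fun x => [:: (1, smap id (omap Some) x)]) t.

Lemma lev_weaken K J (t : form (K + option J)) g w x :
  lev (venv g (ocons x w)) (fweaken t) = lev (venv g w) t.
Proof.
rewrite lev_subst; congr (lev _ t).
by apply/funext => -[k|[j|]]; rewrite lev_var.
Qed.

Lemma nf_cond_top K I J (t : form (K + option J)) (j : J) s :
  nf (fun g w (v : I -> T) => cond_top em top (lev (venv g w) t) (w j) s).
Proof.
apply: nf_imp; first exact: (@nf_eq_top K I J (inl j)).
by apply: nf_and; [exact: nf_in_em|exact: nf_const].
Qed.

Lemma nf_compatible K I J (t : form (K + option J)) (j : J) s t' (j' : J) s' :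
  nf (fun g w (v : I -> T) => compatible pos lt top val
    (lev (venv g w) t) (w j) s (lev (venv g w) t') (w j') s').
Proof.
have E (g : K -> W) (w : J -> T) u u' : lev (venv g w) u - lev (venv g w) u' =
    lev (venv g w) (u ++ fscale (- 1) u').
  by rewrite lev_cat lev_scale scaleN1r.
have nE (u u' : form (K + option J)) (i : J) : nf (fun (g : K -> W) w (v : I -> T) =>
    val (lev (venv g w) u - lev (venv g w) u') = w i).
  apply: (nf_ext _ (@nf_valE K I J (u ++ fscale (- 1) u') (inl i))).
  by move=> g w v; rewrite E.
have nP (u u' : form (K + option J)) : nf (fun (g : K -> W) w (v : I -> T) =>
    pos (lev (venv g w) u - lev (venv g w) u')).
  apply: (nf_ext _ (@nf_pos K I J (u ++ fscale (- 1) u'))).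
  by move=> g w v; rewrite E.
have nL (u u' : form (K + option J)) (i : J) : nf (fun (g : K -> W) w (v : I -> T) =>
    lt (val (lev (venv g w) u - lev (venv g w) u')) (w i)).
  apply: (nf_ext _ (@nf_val_lt K I J (u ++ fscale (- 1) u') (inl i))).
  by move=> g w v; rewrite E.
have n1 := nf_imp (@nf_lt K I J (inl j') (inl j))
  (nf_and (nE t t' j') (nf_iff (nP t t') (nf_const K I J s'))).
have n2 := nf_imp (@nf_eq K I J (inl j) (inl j')) (nf_and (nf_not (nL t t' j))
  (nf_imp (nf_not (@nf_eq_top K I J (inl j))) (nf_imp (nf_const K I J s)
   (nf_imp (nf_const K I J (~ s')) (nf_and (nP t' t) (nE t' t j)))))).
exact: (nf_and n1 n2).
Qed.

(** [L] collects the conditions that earlier probes have put on [y]. A probe whose form does not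
    involve [y] is kept. Any other has the form [q * (y - a)]: its value becomes a variable bound by
    a quantifier over [T], and value and sign join [L]. At a leaf [exists_cond] turns the conditions
    into a statement without [y]. *)
Lemma nf_exW_cond K I J (P : (option K -> W) -> (J -> T) -> (I -> T) -> Prop) :
  nf P -> forall L : seq (form (K + option J) * J * bool),
  nf (fun (g : K -> W) w v => exists y : W,
    (forall c, List.In c L ->
       cond pos val (em y) (lev (venv g w) c.1.1) (w c.1.2) c.2) /\
    P (ocons y g) w v).
Proof.
elim=> {J P} [J P oP|J t P Q _ IHP _ IHQ] L.
  have n1 := nf_allIn L (fun c => @nf_cond_top K I J c.1.1 c.1.2 c.2).
  have n2 := nf_allIn L (fun c => nf_allIn L (fun d =>
    @nf_compatible K I J c.1.1 c.1.2 c.2 d.1.1 d.1.2 d.2)).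
  apply: (nf_ext _ (nf_and (nf_and n1 n2) (nf_leaf K oP))) => g w v.
  split=> [[/(exists_cond H) [y yL] Pwv]|[y [yL Pwv]]]; first by exists y.
  by split=> //; apply/(exists_cond H); exists y.
pose d (x : option K + option J) : option (K + option J) :=
  match x with
  | inl None => None
  | inl (Some k) => Some (inl k)
  | inr o => Some (inr o)
  end.
have [q [b tE]] := lev_split V d t.
have tE' y g w : lev (venv (ocons y g) w) t = q *: em y + lev (venv g w) b.
  by rewrite -tE; congr lev; apply/funext => -[[k|]|o].
pose L' : seq (form (K + option (option J)) * option J * bool) :=
  [seq (fweaken c.1.1, Some c.1.2, c.2) | c <- L].
have L'E y g w x : (forall c, List.In c L' -> cond pos val (em y)
      (lev (venv g (ocons x w)) c.1.1) (ocons x w c.1.2) c.2) <->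
    (forall c, List.In c L -> cond pos val (em y)
      (lev (venv g w) c.1.1) (w c.1.2) c.2).
  split=> hL c cL.
    have := hL _ (List.in_map (fun c => (fweaken c.1.1, Some c.1.2, c.2)) _ _ cL).
    by rewrite lev_weaken.
  have /List.in_map_iff[c' [<- c'L]] := cL.
  by rewrite lev_weaken; exact: hL.
have [q0|q0] := eqVneq q 0.
  apply: (nf_ext _ (nf_probe b (IHP L') (IHQ L'))) => g w v /=.
  split.
    move=> [[pb [y [/L'E yL Py]]]|[pb [y [/L'E yL Py]]]]; exists y; split=> //;
      rewrite tE' q0 scale0r add0r; tauto.
  move=> [y [yL]]; rewrite tE' q0 scale0r add0r.
  by move=> [[pb Py]|[pb Py]]; [left|right]; split=> //; exists y; rewrite L'E.
(* [a] is the zero of the form in [y], so the probe asks for value and sign of [q] times [y - a]. *)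
pose a := fscale (- q^-1) b.
have aE y g w : lev (venv (ocons y g) w) t = q *: (em y - lev (venv g w) a).
  rewrite tE' lev_scale scaleNr opprK scalerDr scalerA divff // scale1r //.
pose A s := (fweaken a, None, s) :: L'.
have AE s y g w x : (forall c, List.In c (A s) -> cond pos val (em y)
      (lev (venv g (ocons x w)) c.1.1) (ocons x w c.1.2) c.2) <->
    cond pos val (em y) (lev (venv g w) a) x s /\
    (forall c, List.In c L -> cond pos val (em y)
      (lev (venv g w) c.1.1) (w c.1.2) c.2).
  split=> [hA|[ha /(L'E _ _ _ x) hL] c /= [<-|/hL//]]; last by rewrite lev_weaken.
  split; last by apply/(L'E _ _ _ x) => c cL; apply: hA; right.
  by have := hA _ (or_introl erefl); rewrite lev_weaken.
pose bq := nf_const K I (option J) (0 < q).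
pose xt := @nf_eq_top K I (option J) (inl None).
(* For [q > 0] the sign of the probe is that of [y - a]. For [q < 0] it is reversed, except that
   [y = a], recognised by the value [top], still leads to the branch [Q]. *)
have n1 := nf_and bq (nf_or (IHP (A true)) (IHQ (A false))).
have n2 := nf_and (nf_not bq) (nf_or (IHQ (A true)) (nf_or
  (nf_and xt (IHQ (A false))) (nf_and (nf_not xt) (IHP (A false))))).
apply: (nf_ext _ (nf_exJ (nf_or n1 n2))) => g w v /=.
have key y : let z := em y - lev (venv g w) a in
    val (lev (venv (ocons y g) w) t) = val z /\
    (0 < q -> (pos (lev (venv (ocons y g) w) t) <-> pos z)) /\
    (~ 0 < q -> (pos (lev (venv (ocons y g) w) t) <-> ~ pos z /\ val z <> top)).
  rewrite /= aE (valZ H) //; split=> //; split=> [qp|qn]; first exact: (posZ_pos H).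
  have qneg : q < 0 by rewrite lt_neqAle q0 leNgt; exact/negP.
  apply: (iff_trans (posZ_neg H _ qneg)); split.
    move=> pz; split; first by move=> /(pos_asym H).
    move/(val_top H) => z0; move: pz; rewrite z0 oppr0; exact: (pos0 H).
  by move=> [npz /(val_neq_top H) nz]; apply/(pos_opp H nz).
split.
  move=> [x [[qp [|]]|[qn [|[[xtop]|[xntop]]]]]] [y [/AE[[vx sy] yL] PQ]];
    exists y; split=> //; have [vE [kp kn]] := key y; rewrite vE vx.
  - by left; split=> //; apply/(kp qp)/sy.
  - by right; split=> //; move/(kp qp)/sy.
  - by right; split=> //; move/(kn qn) => -[np _]; apply: np; apply/sy.
  - by right; split=> //; move/(kn qn) => -[_]; rewrite vx xtop.
  - by left; split=> //; apply/(kn qn); rewrite vx; split=> // /sy.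
move=> [y [yL]]; have [-> [kp kn]] := key y.
set z := em y - _ in kp kn * => hPQ; exists (val z).
have AC (s : bool) : (pos z <-> s) -> forall c, List.In c (A s) -> cond pos val (em y)
      (lev (venv g (ocons (val z) w)) c.1.1) (ocons (val z) w c.1.2) c.2.
  by move=> ps; apply/AE.
have sT : pos z -> (pos z <-> true) by [].
have sF : ~ pos z -> (pos z <-> false) by move=> np; split.
have [qp|qn] := EM (0 < q).
  left; split=> //; case: hPQ => [[/(kp qp) pz Py]|[npz Qy]].
    by left; exists y; split=> //; exact: (AC _ (sT pz)).
  right; exists y; split=> //; apply: AC; apply: sF => pz; apply: npz; exact/(kp qp).
right; split=> //; case: hPQ => [[/(kn qn)[pz zt] Py]|[npz Qy]].
  by right; right; split=> //; exists y; split=> //; exact: (AC _ (sF pz)).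
have [pz|nz] := EM (pos z).
  by left; exists y; split=> //; exact: (AC _ (sT pz)).
right; left; split; last by exists y; split=> //; exact: (AC _ (sF nz)).
by apply: contrapT => zt; apply: npz; apply/(kn qn).
Qed.

Lemma nf_exW K I J (P : (option K -> W) -> (J -> T) -> (I -> T) -> Prop) :
  nf P -> nf (fun g w v => exists y : W, P (ocons y g) w v).
Proof.
move=> nP; apply: (nf_ext _ (nf_exW_cond nP [::])) => g w v.
by split=> [[y [_ Py]]|[y Py]]; exists y.
Qed.

End NormalForm.

(** * Models of T0 *)

Section Couple.
Variables (G : porderZmodType) (psi : G -> G).
Hypothesis hm : T0_model psi.

Let ac := T0_couple hm.
Let og := AC_group ac.

Lemma T0_le_total (a b : G) : a <= b \/ b < a.
Proof.
have [|nab] := boolP (a <= b); first by left.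
right; rewrite lt_neqAle; have := og_total og a b; rewrite (negbTE nab) /= => ->.
by rewrite andbT; apply: contraNneq nab => ->.
Qed.

Lemma T0_ltD2r (c a b : G) : a < b -> a + c < b + c.
Proof.
rewrite !lt_neqAle => /andP[ne le]; rewrite (og_lerD2r og) // andbT.
by apply: contra ne => /eqP/addIr ->.
Qed.

Lemma T0_addr_gt0 (a b : G) : 0 < a -> 0 < b -> 0 < a + b.
Proof. by move=> a0 b0; apply: lt_trans b0 _; rewrite -{1}(add0r b); exact: T0_ltD2r. Qed.

Lemma T0_subr_gt0 (a b : G) : 0 < b - a <-> a < b.
Proof.
split=> [/(T0_ltD2r a)|/(T0_ltD2r (- a))]; first by rewrite add0r subrK.
by rewrite subrr.
Qed.

Lemma T0_oppr_gt0 (a : G) : a < 0 <-> 0 < - a.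
Proof. by rewrite -(T0_subr_gt0 a 0) sub0r. Qed.

Lemma T0_mulrn_gt0 (a : G) n : 0 < a -> 0 < a *+ n.+1.
Proof. by move=> a0; elim: n => // n IH; rewrite mulrS; exact: T0_addr_gt0. Qed.

Lemma T0_mulrn_eq0 (a : G) n : a *+ n.+1 = 0 -> a = 0.
Proof.
move=> an; have [a0|a0] := T0_le_total a 0; last first.
  by have := T0_mulrn_gt0 n a0; rewrite an ltxx.
have [//|/eqP ne] := EM (a = 0).
have /T0_oppr_gt0/(T0_mulrn_gt0 n) : a < 0 by rewrite lt_neqAle ne.
by rewrite mulNrn an oppr0 ltxx.
Qed.

Lemma T0_mulrz_eq0 (a : G) (d : int) : d != 0 -> a *~ d = 0 -> a = 0.
Proof.
case: d => [[|n]|n] // _; first exact: T0_mulrn_eq0.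
by rewrite NegzE mulrNz => /eqP; rewrite oppr_eq0 => /eqP; exact: T0_mulrn_eq0.
Qed.

Lemma T0_mulrz_inj (a b : G) (d : int) : d != 0 -> a *~ d = b *~ d -> a = b.
Proof.
move=> d0 ab; apply/eqP; rewrite -subr_eq0; apply/eqP.
by apply: (T0_mulrz_eq0 d0); rewrite mulrzBl ab subrr.
Qed.

(** Divisibility provides such an element and torsion-freeness makes it unique, so the default 0 is
    harmless. *)
Definition qscale (q : rat) (a : G) : G :=
  xget 0 [set b | b *~ denq q = a *~ numq q]%classic.

Lemma qscaleP q a : qscale q a *~ denq q = a *~ numq q.
Proof.
have [d dE] := denqP q.
have [b bE] := @T0_divisible _ _ hm d.+1 (a *~ numq q) isT.
by apply: (@xgetI _ 0 [set b | b *~ denq q = a *~ numq q]%classic b); rewrite /= dE.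
Qed.

(** Any fraction representing [q], reduced or not, determines [qscale q a]; the laws of a vector
    space follow by taking common denominators. *)
Lemma qscaleE q a b (n d : int) : d != 0 -> q * d%:~R = n%:~R ->
  b *~ d = a *~ n -> b = qscale q a.
Proof.
move=> d0 qE bE; apply: (@T0_mulrz_inj _ _ (d * denq q)).
  by rewrite mulf_neq0 ?denq_neq0.
rewrite mulrzA bE [d * _]mulrC mulrzA qscaleP -!mulrzA; congr (_ *~ _).
apply/eqP; rewrite -(eqr_int rat) !rmorphM /= numqE -qE.
by apply/eqP; ring.
Qed.

Lemma qscaleA q r a : qscale q (qscale r a) = qscale (q * r) a.
Proof.
apply: (@qscaleE _ _ _ (numq q * numq r) (denq q * denq r)).
- by rewrite mulf_neq0 ?denq_neq0.
- by rewrite !rmorphM /= !numqE; ring.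
- by rewrite mulrzA qscaleP mulrzAC qscaleP -mulrzA [numq r * _]mulrC.
Qed.

Lemma qscale1 a : qscale 1 a = a.
Proof. by apply/esym; apply: (@qscaleE _ _ _ 1 1). Qed.

Lemma qscaleDr : right_distributive qscale +%R.
Proof.
move=> q a b; apply/esym; apply: (@qscaleE _ _ _ (numq q) (denq q)).
- exact: denq_neq0.
- by rewrite numqE.
- by rewrite !mulrzDl !qscaleP.
Qed.

Lemma qscaleDl a : {morph qscale^~ a : q r / q + r}.
Proof.
move=> q r; apply/esym.
apply: (@qscaleE _ _ _ (numq q * denq r + numq r * denq q) (denq q * denq r)).
- by rewrite mulf_neq0 ?denq_neq0.
- by rewrite rmorphD !rmorphM /= !numqE; ring.
- rewrite mulrzDl mulrzDr; congr (_ + _).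
    by rewrite mulrzA qscaleP mulrzA.
  by rewrite mulrzA mulrzAC qscaleP mulrzA.
Qed.

Lemma qscale_gt0 q a : 0 < q -> 0 < a -> 0 < qscale q a.
Proof.
move=> q0 a0; have [//|/eqP ne] := EM (0 < qscale q a).
have qP := qscaleP q a; have [d dE] := denqP q; rewrite dE in qP.
have : 0 < numq q by rewrite numq_gt0.
case: (numq q) qP => [[|n]|n] // qP _.
have pa : 0 < a *+ n.+1 by exact: T0_mulrn_gt0.
have [le|//] := T0_le_total (qscale q a) 0.
have [z|/eqP z] := EM (qscale q a = 0).
  have : a *+ n.+1 = 0 by rewrite -[LHS]qP z mul0rz.
  by move=> E; rewrite E ltxx in pa.
have /T0_oppr_gt0/(T0_mulrn_gt0 d) : qscale q a < 0 by rewrite lt_neqAle z.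
rewrite mulNrn => /(T0_addr_gt0 pa).
have -> : qscale q a *+ d.+1 = a *+ n.+1 by [].
by rewrite subrr ltxx.
Qed.

Lemma psi_qscale q a : q != 0 -> a != 0 -> qscale q a != 0 /\ psi (qscale q a) = psi a.
Proof.
move=> q0 a0; have qP := qscaleP q a.
have q_neq0 : qscale q a != 0.
  apply: contraNneq a0 => z; apply/eqP.
  by apply: (@T0_mulrz_eq0 _ (numq q)); rewrite ?numq_eq0 // -qP z mul0rz.
split=> //; rewrite -(AC2 ac (denq_neq0 q)) // qP (AC2 ac) //.
by rewrite numq_eq0.
Qed.

Local Notation s := (ac_succ psi).

Lemma ac_integralP a : ac_integral psi a != 0 /\ ac_deriv psi (ac_integral psi a) = a.
Proof.
rewrite /ac_integral.
apply: (@xgetPex _ 0 [set b | b != 0 /\ ac_deriv psi b = a]%classic).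

have : (setT a) by []; rewrite -(T0_integration hm) => -[b b0 ba].
by exists b.
Qed.

Lemma psi_succ_Psi a : Psi psi (s a).
Proof. by have [h _] := ac_integralP a; exists (ac_integral psi a). Qed.

Lemma psiN a : a != 0 -> psi (- a) = psi a.
Proof. by move=> a0; rewrite -mulrN1z (AC2 ac). Qed.

Lemma psi_dom a b : a != 0 -> b != 0 -> psi a < psi b ->
  a + b != 0 /\ psi (a + b) = psi a.
Proof.
move=> a0 b0 ab; have nab : a + b != 0.
  apply/eqP => /eqP; rewrite addr_eq0 => /eqP aE.
  by rewrite aE psiN ?ltxx in ab.
split=> //; have le : psi a <= psi (a + b).
  by have := AC1 ac a0 b0 nab; rewrite minElt ab.
apply/eqP; apply: contraT => ne.
have lt : psi a < psi (a + b) by rewrite lt_neqAle eq_sym ne.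
have nb : - b != 0 by rewrite oppr_eq0.
have := AC1 ac nab nb; rewrite addrK minElt psiN // => /(_ a0).
case: ifP => _ /le_lt_trans h; first by have := h _ lt; rewrite ltxx.
by have := h _ ab; rewrite ltxx.
Qed.

(** Write [a = x + psi x] and [b = y + psi y] with [psi x < psi y]. Then [b - a] is the sum of
    [y - x], of value [psi x], and of [psi y - psi x], which has a larger value and does not
    matter. *)
Lemma succ_sub a b : s a < s b -> b - a != 0 /\ psi (b - a) = s a.
Proof.
have [a0 aE] := ac_integralP a; have [b0 bE] := ac_integralP b.
rewrite /ac_succ; set x := ac_integral psi a in a0 aE *.
set y := ac_integral psi b in b0 bE * => xy.
have x0 : - x != 0 by rewrite oppr_eq0.
have [d0 dE] : - x + y != 0 /\ psi (- x + y) = psi x.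
  by have := @psi_dom (- x) y x0 b0; rewrite psiN //; apply.
have k0 : psi y - psi x != 0 by rewrite subr_eq0 gt_eqF.
have kx : psi x < psi (psi y - psi x).
  (* Axiom AC3 for the positive element [psi y - psi x] and for [y]: cancelling [psi y] leaves the
     desired bound. *)
  have := AC3 ac k0 b0 (proj2 (T0_subr_gt0 _ _) xy).
  move=> /(T0_ltD2r (psi x - psi y)); rewrite addrC subrK.
  by rewrite [_ - _ + psi _]addrC -addrA subrKA subrr addr0.
have -> : b - a = (- x + y) + (psi y - psi x).
  rewrite -aE -bE /ac_deriv opprD addrACA [- x + y]addrC.
  by [].
by rewrite -dE; apply: psi_dom; rewrite ?dE.
Qed.

End Couple.

(** An alias of [G] that carries the rational vector space structure; the argument [hm] gives the
    instance access to divisibility and torsion-freeness. *)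
Definition couple_vect (G : porderZmodType) (psi : G -> G)
  (hm : T0_model psi) : Type := G.

HB.instance Definition _ (G : porderZmodType) (psi : G -> G)
  (hm : T0_model psi) := GRing.Zmodule.copy (couple_vect hm) G.

HB.instance Definition _ (G : porderZmodType) (psi : G -> G)
    (hm : T0_model psi) :=
  GRing.Zmodule_isLmodule.Build rat (couple_vect hm)
    (qscaleA hm) (qscale1 hm) (qscaleDr hm) (qscaleDl hm).

(** * The cut space of a model *)

Section CoupleCut.
Variables (G : porderZmodType) (psi : G -> G).
Hypothesis hm : T0_model psi.

Local Notation s := (ac_succ psi).
Local Notation pinf x := (psi_inf psi (Some (x : G))).
Local Notation W := (couple_vect hm).
Local Notation V := (couple_vect hm * rat^o)%type.

Definition cut_em (a : W) : V := (a, 0).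

Lemma cut_em_linear : linear cut_em.
Proof. by move=> q a b; congr (_, _); rewrite /= scaler0 addr0. Qed.

HB.instance Definition _ := GRing.isLinear.Build rat W V *:%R cut_em cut_em_linear.

Definition Psi_top := option {x : G | Psi psi x}.

Definition tval (t : Psi_top) : option G := omap sval t.

Definition cut_lt (t u : Psi_top) : Prop := lt_inf (tval t) (tval u).

Lemma tval_inj : injective tval.
Proof.
move=> [[x px]|] [[y py]|] //= [xy]; case: y / xy py => py.
by rewrite (Prop_irrelevance px py).
Qed.

(* The pair (a, c) stands for a + c * omega, where omega is a pseudolimit of
   Psi; evaluating omega at sufficiently large elements of Psi computes it. *)
Definition cut_eval (z : G) (p : V) : W := p.1 + (p.2 : rat) *: (z : W).

(** The filter generated by the open final segments of Psi. It is proper because Psi has no greatest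
    element. *)
Definition ultimately (P : G -> Prop) : Prop :=
  exists2 x, Psi psi x & forall z, Psi psi z -> x < z -> P z.

Lemma cut_evalD z p q : cut_eval z (p + q) = cut_eval z p + cut_eval z q.
Proof. by rewrite /cut_eval /= scalerDl addrACA. Qed.

Lemma cut_evalZ z c p : cut_eval z (c *: p) = c *: cut_eval z p.
Proof. by rewrite /cut_eval /= scalerDr scalerA. Qed.

Lemma cut_eval0 z : cut_eval z 0 = 0.
Proof. by rewrite /cut_eval /= scale0r addr0. Qed.

Lemma cut_evalN z p : cut_eval z (- p) = - cut_eval z p.
Proof. by rewrite -scaleN1r cut_evalZ scaleN1r. Qed.

Lemma succ_gt x : Psi psi x -> x < s x.
Proof. by move/(T0_successor hm) => []. Qed.

Lemma succ_mono x y : Psi psi x -> Psi psi y -> x < y -> s x < s y.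
Proof.
move=> px py xy; have [_ _ /(_ _ py xy) le] := T0_successor hm px.
exact: le_lt_trans le (succ_gt py).
Qed.

Lemma ultimately_and P Q :
  ultimately P -> ultimately Q -> ultimately (fun z => P z /\ Q z).
Proof.
move=> [x px hP] [y py hQ]; have [xy|yx] := T0_le_total hm x y.
  by exists y => // z pz yz; split; [apply: hP => //; exact: le_lt_trans yz|exact: hQ].
by exists x => // z pz xz; split; [exact: hP|apply: hQ => //; exact: lt_trans xz].
Qed.

Lemma ultimately_ex P : ultimately P -> exists2 z, Psi psi z & P z.
Proof.
move=> [x px hP]; exists (s x); first exact: (psi_succ_Psi hm).
by apply: hP (succ_gt px); exact: (psi_succ_Psi hm).
Qed.

Lemma ultimately_mono (P Q : G -> Prop) :
  (forall z, Psi psi z -> P z -> Q z) -> ultimately P -> ultimately Q.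
Proof. by move=> PQ [x px hP]; exists x => // z pz /(hP z pz); exact: PQ. Qed.

Lemma ultimately_const (A : Prop) : A -> ultimately (fun=> A).
Proof. by move=> a; exists (s 0) => //; exact: (T0_s0_in hm). Qed.

Lemma psi_infZ (c : rat) (a : W) : c != 0 -> pinf (c *: a) = pinf a.
Proof.
move=> c0; have [->|a0] := eqVneq a 0; first by rewrite scaler0.
have [ca0 caE] := psi_qscale hm c0 a0.
rewrite /psi_inf; have -> : (c *: a == 0) = false by exact/negbTE.
by rewrite (negbTE a0); congr Some.
Qed.

Lemma psi_infN (a : G) : pinf (- a) = pinf a.
Proof.
rewrite /psi_inf oppr_eq0; have [//|a0] := eqVneq a 0.
by rewrite (psiN hm).
Qed.

(** All elements of Psi beyond [s a] have the same value [s a] as seen from [a], so evaluation at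
    large elements stabilises; this is the identity [psi (omega - a) = s a]. *)
Lemma psi_inf_sub a z : Psi psi z -> s a < z -> pinf (z - a) = Some (s a).
Proof.
move=> pz az; have [d0 dE] := succ_sub hm (lt_trans az (succ_gt pz)).
by rewrite /psi_inf (negbTE d0) dE.
Qed.

Lemma cut_eval_unit z (p : V) : (p.2 : rat) != 0 ->
  cut_eval z p = (p.2 : rat) *: ((z : W) - - (p.2 : rat)^-1 *: p.1).
Proof.
by move=> c0; rewrite scaleNr opprK scalerDr scalerA divff // scale1r addrC.
Qed.

Lemma exists_cut_val (p : V) : exists t, ultimately (fun z =>
  pinf (cut_eval z p) = tval t).
Proof.
have [c0|c0] := eqVneq (p.2 : rat) 0.
  have [a0|a0] := eqVneq p.1 0.
    exists None; apply: ultimately_mono (ultimately_const I) => z _ _.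
    by rewrite /cut_eval c0 a0 scale0r addr0 /psi_inf eqxx.
  have pa : Psi psi (psi p.1) by exists p.1.
  exists (Some (exist _ _ pa)).
  apply: ultimately_mono (ultimately_const I) => z _ _.
  by rewrite /cut_eval c0 scale0r addr0 /psi_inf (negbTE a0).
(* Up to the nonzero factor [p.2], the vector [p] is omega minus [g], whose value is [s g]. *)
set g : W := - (p.2 : rat)^-1 *: p.1.
exists (Some (exist _ _ (psi_succ_Psi hm g))), (s g) => [|z pz gz].
  exact: (psi_succ_Psi hm).
by rewrite cut_eval_unit // psi_infZ //; exact: psi_inf_sub.
Qed.

Lemma cut_sign (p : V) : p != 0 ->
  ultimately (fun z => (0 : G) < cut_eval z p) \/
  ultimately (fun z => (0 : G) < cut_eval z (- p)).
Proof.
move=> p0; have Nz z := cut_evalN z p.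
have [c0|c0] := eqVneq (p.2 : rat) 0.
  have E z : cut_eval z p = p.1 by rewrite /cut_eval c0 scale0r addr0.
  have a0 : (p.1 : G) != 0.
    by apply: contraNneq p0 => a0; case: (p) c0 a0 => a c /= -> ->.
  have [le|lt] := T0_le_total hm p.1 0; [right|left];
    apply: ultimately_mono (ultimately_const I) => z _ _.
    by rewrite Nz E; apply/(T0_oppr_gt0 hm); rewrite lt_neqAle a0.
  by rewrite E.
set g : G := - (p.2 : rat)^-1 *: p.1.
have sgn : ultimately (fun z => (0 : G) < z - g) \/
    ultimately (fun z => (0 : G) < - (z - g)).
  have [[x px gx]|ng] := EM (exists2 x, Psi psi x & g < x).
    by left; exists x => // z pz xz; apply/(T0_subr_gt0 hm); exact: lt_trans xz.
  (* If no element of Psi exceeds [g], only equality of [g] and [z] has to be excluded; beyond [s g]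
     it fails since the difference has the finite value [s g]. *)
  right; exists (s g) => [|z pz gz]; first exact: (psi_succ_Psi hm).
  rewrite opprB; apply/(T0_subr_gt0 hm).
  have [gz'|//] := T0_le_total hm g z.
  have [E|/eqP ne] := EM (g = z).
    by have := psi_inf_sub pz gz; rewrite -E subrr /psi_inf eqxx.
  by case: ng; exists z => //; rewrite lt_neqAle ne.
have eE z : cut_eval z p = (p.2 : rat) *: ((z - g : G) : W) by exact: cut_eval_unit.
have [cp|cn] := ltP 0 (p.2 : rat).
  have [h|h] := sgn; [left|right]; apply: ultimately_mono h => z _ h.
    by rewrite eE; exact: (qscale_gt0 hm).
  by rewrite Nz eE -scalerN; exact: (qscale_gt0 hm).
have {}cn : 0 < - (p.2 : rat) by rewrite oppr_gt0 lt_neqAle c0.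
have [h|h] := sgn; [right|left]; apply: ultimately_mono h => z _ h.
  by rewrite Nz eE -scaleNr; exact: (qscale_gt0 hm).
by rewrite eE -[X in (0 : G) < X]opprK -scalerN -scaleNr; exact: (qscale_gt0 hm).
Qed.

Definition cut_val (p : V) : Psi_top := sval (cid (exists_cut_val p)).

Definition cut_pos (p : V) : Prop := ultimately (fun z => (0 : G) < cut_eval z p).

(** The default 0 matters: it is the predecessor assigned to the least element [s 0], so that
    [s (Psi_pred x) = x] on all of Psi. *)
Definition Psi_pred (x : G) : G := xget 0 [set y | Psi psi y /\ s y = x]%classic.

Definition cut_lam (t : Psi_top) : V :=
  if t is Some x then cut_em (Psi_pred (sval x)) else (0, 1).

Lemma cut_valP p : ultimately (fun z => pinf (cut_eval z p) = tval (cut_val p)).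
Proof. by rewrite /cut_val; case: cid. Qed.

Lemma cut_valE p t :
  ultimately (fun z => pinf (cut_eval z p) = tval t) -> cut_val p = t.
Proof.
move=> h; have [z _ [hp ht]] := ultimately_ex (ultimately_and (cut_valP p) h).
by apply: tval_inj; rewrite -hp.
Qed.

Lemma Psi_predP x : Psi psi x -> [/\ s (Psi_pred x) = x, Psi_pred x < x &
  Psi psi (Psi_pred x) \/ Psi_pred x = 0].
Proof.
move=> px; have [[y [py yx]]|nx] := EM (exists y, Psi psi y /\ s y = x).
  have [h1 h2] := @xgetI _ 0 [set y | Psi psi y /\ s y = x]%classic y (conj py yx).
  split=> //; last by left.
  by rewrite -[ltRHS]h2; exact: succ_gt.
have x0 : x = s 0.
  have := T0_s0_least hm px; rewrite le_eqVlt => /orP[/eqP//|lt].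
  have [_ _ sur] := T0_bij hm.
  by have [y py yx] := sur x (conj px lt); case: nx; exists y.
have -> : Psi_pred x = 0.
  by apply: xgetPN => y [py yx]; apply: nx; exists y.
by split; [|rewrite x0; exact: (T0_s0_gt0 hm)|right].
Qed.

Lemma pinf_valD (a b : G) t : ~ lt_inf (pinf a) t -> ~ lt_inf (pinf b) t ->
  ~ lt_inf (pinf (a + b)) t.
Proof.
rewrite /psi_inf; have [->|a0] := eqVneq a 0; first by rewrite add0r.
have [->|b0] := eqVneq b 0; first by rewrite addr0 (negbTE a0).
have [_|ab0] := eqVneq (a + b) 0; first by move=> _ _ [].
case: t => [t|] //= at_ bt abt.
have := AC1 (T0_couple hm) a0 b0 ab0.
rewrite minElt; case: ifP => _ /le_lt_trans/(_ abt); [exact: at_|exact: bt].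
Qed.

Lemma pinf_convex (a b : G) : 0 < a -> 0 < b -> ~ lt_inf (pinf a) (pinf (a + b)).
Proof.
move=> a0 b0; have ab0 := T0_addr_gt0 hm a0 b0.
rewrite /psi_inf !gt_eqF //=.
have le : a <= a + b.
  by apply: ltW; rewrite -{1}(add0r a) [a + b]addrC; exact: (T0_ltD2r hm).
by move/lt_le_trans/(_ (T0_H_type hm a0 le)); rewrite ltxx.
Qed.

(** Each clause about vectors involves finitely many eventual statements. It is proved either for
    all large elements of Psi or at a single element where all these statements hold. *)
Lemma cut_space_T0 :
  cut_space (cut_em : {linear W -> V}) cut_pos cut_lt None cut_val cut_lam.
Proof.
have irr t : ~ lt_inf t (t : option G) by case: t => [x|] //=; rewrite ltxx.
split.
- by move=> t; exact: irr.
- move=> [x|] [y|] [z|] //=; rewrite /cut_lt /=; exact: lt_trans.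
- move=> [[x px]|] [[y py]|]; rewrite /cut_lt /=; last first.
  + by constructor 2.
  + by constructor 3.
  + by constructor 1.
  have [xy|yx] := T0_le_total hm x y; last by constructor 3.
  have [E|/eqP ne] := EM (x = y); last by constructor 1; rewrite lt_neqAle ne.
  by constructor 2; apply: tval_inj; rewrite /= E.
- by move=> x [].
- move/ultimately_ex => [z _]; by rewrite cut_eval0 ltxx.
- move=> a b /ultimately_and h /h; apply: ultimately_mono => z _ [az bz].
  by rewrite cut_evalD; exact: (T0_addr_gt0 hm).
- move=> q a q0; apply: ultimately_mono => z _ az.
  by rewrite cut_evalZ; exact: (qscale_gt0 hm).
- by move=> a /cut_sign.
- move=> a; split=> [va|->]; last first.
    apply: cut_valE; apply: ultimately_mono (ultimately_const I) => z _ _.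
    by rewrite cut_eval0 /psi_inf eqxx.
  apply/eqP; apply: contraT => /cut_sign sa.
  have h0 := cut_valP a; rewrite va in h0.
  case: sa => /ultimately_and/(_ h0)/ultimately_ex[z _ [+ hz]].
    by move: hz; rewrite /psi_inf; case: eqP => // ->; rewrite ltxx.
  rewrite cut_evalN; move: hz; rewrite /psi_inf; case: eqP => // ->.
  by rewrite oppr0 ltxx.
- move=> q a q0; apply: cut_valE; apply: ultimately_mono (cut_valP a) => z _.
  by rewrite cut_evalZ psi_infZ.
- move=> a b x xa xb.
  have /ultimately_ex[z _ [[ha hb] hab]] := ultimately_and (ultimately_and
    (cut_valP a) (cut_valP b)) (cut_valP (a + b)).
  rewrite /cut_lt -hab cut_evalD; apply: pinf_valD; first by rewrite ha.
  by rewrite hb.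
- move=> a b pa pb.
  have /ultimately_ex[z _ [[[ha hb] hab] pab]] := ultimately_and (ultimately_and
    (ultimately_and pa pb) (cut_valP a)) (cut_valP (a + b)).
  by rewrite /cut_lt -hab -pab cut_evalD; exact: pinf_convex.
- move=> [[x px]|] // _; have [y y0 yx] := px; exists (cut_em y).
  apply: cut_valE; apply: ultimately_mono (ultimately_const I) => z _ _.
  by rewrite /cut_eval /= scale0r addr0 /psi_inf (negbTE y0) yx.
(* Replacing omega by [x] in [b] changes it by a multiple of [x - omega], which is zero or has value
   [s x], and [s x] exceeds [x]. *)
- move=> b [[x px]|] // _; exists (cut_eval x b).
  have E z : cut_eval z (cut_em (cut_eval x b) - b) = (b.2 : rat) *: ((x : W) - z).
    rewrite cut_evalD cut_evalN /cut_eval /= scale0r addr0 opprD addrACA subrr add0r.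
    by rewrite scalerBr.
  have [c0|c0] := eqVneq (b.2 : rat) 0.
    have -> // : cut_val (cut_em (cut_eval x b) - b) = None.
    apply: cut_valE; apply: ultimately_mono (ultimately_const I) => z _ _.
    by rewrite E c0 scale0r /psi_inf eqxx.
  have -> : cut_val (cut_em (cut_eval x b) - b) =
      Some (exist _ _ (psi_succ_Psi hm x)).
    apply: cut_valE; exists (s x) => [|z pz xz]; first exact: (psi_succ_Psi hm).
    rewrite E psi_infZ // -psi_infN opprB; exact: psi_inf_sub.
  exact: succ_gt.
- move=> [[x px]|] // [[y py]|] xy; apply: cut_valE.
    apply: ultimately_mono (ultimately_const I) => z _ _.
    have [sx _ _] := Psi_predP px; have [sy _ _] := Psi_predP py.
    have -> : cut_lam (Some (exist _ _ py)) - cut_lam (Some (exist _ _ px)) =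
       cut_em (Psi_pred y - Psi_pred x) by rewrite linearB.
    rewrite /cut_eval /= scale0r addr0.
    have [|d0 dE] := @succ_sub _ _ hm (Psi_pred x) (Psi_pred y).
      by rewrite sx sy.
    by rewrite /psi_inf (negbTE d0) dE sx.
  have [sx _ _] := Psi_predP px; exists x => // z pz xz.
  rewrite cut_evalD cut_evalN /cut_eval /= scale0r addr0 scale1r add0r.
  by have := @psi_inf_sub (Psi_pred x) z pz; rewrite sx; exact.
- move=> [[x px]|] // [[y py]|] xy; have [sx ltx hx] := Psi_predP px.
    apply: ultimately_mono (ultimately_const I) => z _ _.
    have -> : cut_lam (Some (exist _ _ py)) - cut_lam (Some (exist _ _ px)) =
       cut_em (Psi_pred y - Psi_pred x) by rewrite linearB.
    rewrite /cut_eval /= scale0r addr0; apply/(T0_subr_gt0 hm).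
    have {}xy : x < y := xy.
    (* If the predecessor of [y] is the default 0, then [y] is the least element [s 0] and cannot
       exceed [x]. *)
    have [sy lty [hy|y0]] := Psi_predP py; last first.
      have := T0_s0_least hm px; move/le_lt_trans/(_ xy).
      by rewrite -sy y0 ltxx.
    case: hx => [hx|->]; last first.
      exact: lt_le_trans (T0_s0_gt0 hm) (T0_s0_least hm hy).
    have [yx|//] := T0_le_total hm (Psi_pred y) (Psi_pred x).
    move: yx; rewrite le_eqVlt => /orP[/eqP yx|/(succ_mono hy hx)].
      by move: xy; rewrite -sx -sy yx ltxx.
    by rewrite sx sy => /(lt_trans xy); rewrite ltxx.
  exists x => // z pz xz.
  rewrite cut_evalD cut_evalN /cut_eval /= scale0r addr0 scale1r add0r.
  by apply/(T0_subr_gt0 hm); exact: lt_trans ltx xz.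
- by move=> [[x px]|] // _; exists (Psi_pred x).
- by move=> a c [_ c0]; rewrite -[c]mulr1; exact: (esym c0).
Qed.

End CoupleCut.

(** * From formulas of the language to normal forms *)

Section Translation.
Variables (G : porderZmodType) (psi : G -> G).
Hypothesis hm : T0_model psi.

Local Notation s := (ac_succ psi).
Local Notation W := (couple_vect hm).
Local Notation T := (Psi_top psi).
Local Notation M := (Tlog_structure psi).
Local Notation L := log_language.
Local Notation H := (cut_space_T0 hm).
Local Notation em := (@cut_em G psi hm : {linear W -> _}).
Local Notation lt := (@cut_lt G psi).

(** Elements of Psi occur in formulas of the language as elements of [G], so the context of leaf
    variables is empty here. *)
Definition dfn (K J : Type) (P : (K -> W) -> (J -> T) -> Prop) : Prop :=
  @nf W (couple_vect hm * rat^o)%type em (@cut_pos G psi hm) T lt None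
    (@cut_val G psi hm) (@cut_lam G psi hm) K void J (fun g w _ => P g w).

Definition dfn2 (R : W -> W -> Prop) : Prop :=
  forall (K J : Type) (i j : K), dfn (fun g (w : J -> T) => R (g i) (g j)).

Lemma cut_val_em (a : W) t : cut_val (em a) = t <-> psi_inf psi (Some (a : G)) = tval t.
Proof.
have E z : cut_eval z (em a) = a by rewrite /cut_eval /= scale0r addr0.
split=> [<-|h]; last first.
  by apply: cut_valE; apply: ultimately_mono (ultimately_const hm I) => z _ _; rewrite E.
by have /(ultimately_ex hm)[z _] := cut_valP (em a); rewrite E.
Qed.

Lemma cut_pos_em (a : W) : cut_pos (em a) <-> (0 : G) < a.
Proof.
have E z : cut_eval z (em a) = a by rewrite /cut_eval /= scale0r addr0.
split=> [/(ultimately_ex hm)[z _]|h]; first by rewrite E.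
by apply: ultimately_mono (ultimately_const hm I) => z _ _; rewrite E.
Qed.

(** Turns the successor function into a probe of a linear form. *)
Lemma cut_val_omega_sub (a : W) :
  cut_val (cut_lam hm None - em a) = Some (exist _ _ (psi_succ_Psi hm a)).
Proof.
apply: cut_valE; exists (s a) => [|z pz az]; first exact: (psi_succ_Psi hm).
rewrite cut_evalD cut_evalN {2}/cut_eval /= scale0r addr0 /cut_eval /=.
have := psi_inf_sub hm pz az; rewrite /psi_inf /=.
by rewrite scale1r add0r.
Qed.

Lemma cut_lam_succ (x : G) (px : Psi psi x) :
  cut_lam hm (Some (exist _ _ (psi_succ_Psi hm x))) = em x.
Proof.
rewrite /cut_lam /=; congr cut_em.
have [sE _ hx] := Psi_predP hm (psi_succ_Psi hm x).
(* The default is excluded: predecessor 0 would give [s x = s 0], but [s 0 <= x < s x]. *)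
have px' : Psi psi (Psi_pred psi (s x)).
  case: hx => // x0; have := succ_gt hm px.
  rewrite -sE x0 => /lt_le_trans/(_ (T0_s0_least hm px)).
  by rewrite ltxx.
have [_ inj _] := T0_bij hm.
by apply: inj; rewrite ?inE.
Qed.

Lemma em_inj : injective (@cut_em G psi hm).
Proof. by move=> a b []. Qed.

Lemma dfn_linear K J (t : form K) :
  dfn (fun g (w : J -> T) => lev (fun k => g k) t = 0 :> W).
Proof.
pose t' : form (K + option J) := [seq (c.1, inl c.2) | c <- t].
apply: (nf_ext _ (@nf_zero _ _ _ _ _ _ _ _ _ H K void J t')) => g w v.
have -> : lev (venv em None (cut_lam hm) g w) t' = em (lev g t).
  by rewrite /lev big_map linear_sum; apply: eq_bigr => c _; rewrite linearZ.
by split=> [h|->]; [apply: em_inj|]; rewrite ?h linear0.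
Qed.

Lemma dfn_lt : dfn2 (fun a b => (a : G) < b).
Proof.
move=> K J i j; pose t : form (K + option J) := [:: (1, inl j); (- 1, inl i)].
apply: (nf_ext _ (@nf_pos W _ em _ T lt None _ (@cut_lam G psi hm) K void J t)) => g w v.
have -> : lev (venv em None (cut_lam hm) g w) t = em (g j - g i).
  by rewrite !lev_cons lev_nil addr0 scale1r scaleN1r linearB.
apply: (iff_trans (cut_pos_em _)); exact: (T0_subr_gt0 hm).
Qed.

Lemma dfn_opp : dfn2 (fun a b => opp_inf (Some (a : G)) = Some (b : G)).
Proof.
move=> K J i j; pose t : form K := [:: (1, i); (1, j)].
apply: (nf_ext _ (dfn_linear J t)) => g w v.
rewrite !lev_cons lev_nil addr0 !scale1r; split=> [/eqP|[<-]]; last first.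
  by rewrite subrr.
by rewrite addr_eq0 => /eqP ->; rewrite /opp_inf /= opprK.
Qed.

Lemma dfn_div n : dfn2 (fun a b => div_inf n.+1 (Some (a : G)) = Some (b : G)).
Proof.
move=> K J i j; pose t : form K := [:: (n.+1%:R, j); (- 1, i)].
apply: (nf_ext _ (dfn_linear J t)) => g w v.
rewrite !lev_cons lev_nil addr0 scaleN1r scaler_nat.
have [b /= bE] := T0_divisible hm (g i : G) (isT : (0 < n.+1)%N).
have := @xgetI _ 0 [set b : G | b *+ n.+1 = g i]%classic b bE.
rewrite /div_inf /=; set x := xget _ _ => /= xE.
split=> [/eqP|[<-]]; last first.
  by have -> : (x : W) *+ n.+1 = g i by []; rewrite subrr.
rewrite subr_eq0 => /eqP gE; congr Some; apply/eqP; rewrite -subr_eq0; apply/eqP.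
apply: (@T0_mulrn_eq0 _ _ hm _ n); rewrite mulrnBl xE.
by apply/eqP; rewrite subr_eq0; apply/eqP; exact: (esym gE).
Qed.

Lemma dfn_exW K J (P : (option K -> W) -> (J -> T) -> Prop) :
  dfn P -> dfn (fun g w => exists y : W, P (ocons y g) w).
Proof. by move=> dP; exact: (nf_exW H dP). Qed.

Lemma dfn_exJ K J (P : (K -> W) -> (option J -> T) -> Prop) :
  dfn P -> dfn (fun g w => exists x, P g (ocons x w)).
Proof. by move=> dP; exact: (nf_exJ H dP). Qed.

Lemma dfn_cut_lt K J (j k : J) : dfn (fun (g : K -> W) w => lt (w j) (w k)).
Proof. exact: (@nf_lt _ _ em _ _ lt None _ _ K void J (inl j) (inl k)). Qed.

Lemma dfn_imm_succ K J (j k : J) :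
  dfn (fun (g : K -> W) w => lt (w j) (w k) /\
    forall z, lt (w j) z -> ~ lt z (w k)).
Proof.
apply: nf_and; first exact: dfn_cut_lt.
have n2 : dfn (fun (g : K -> W) (w : option J -> T) =>
    lt (w (Some j)) (w None) /\ lt (w None) (w (Some k))).
  by apply: nf_and; exact: dfn_cut_lt.
apply: (nf_ext _ (nf_not (dfn_exJ n2))) => g w v; split.
  by move=> nz z jz zk; apply: nz; exists z.
by move=> az [z [jz zk]]; exact: (az z jz).
Qed.

(** An element [u] of Psi equals [lam (s u)], and [s u] is its immediate successor in the order of
    values. Hence equality with [u] is the vanishing of a linear form in [lam] of that successor.
    For the value [None] there is no successor, and both sides are false. *)
Lemma dfn_in_Psi K J (i : K) (j : J) :
  dfn (fun g w => Some (g i : G) = tval (w j)).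
Proof.
have n1 : dfn (fun (g : K -> W) (w : option J -> T) =>
    (lt (w (Some j)) (w None) /\ forall z, lt (w (Some j)) z -> ~ lt z (w None)) /\
    lev (venv em None (cut_lam hm) g w)
      [:: (1, inl i); (- 1, inr (Some None))] = 0).
  by apply: nf_and; [exact: dfn_imm_succ|exact: (nf_zero H)].
apply: (nf_ext _ (dfn_exJ n1)) => g w v.
have E' x : lev (venv em None (cut_lam hm) g (ocons x w))
    [:: (1, inl i); (- 1, inr (Some None))] = em (g i) - cut_lam hm x.
  by rewrite !lev_cons lev_nil addr0 scale1r scaleN1r.
case wj : (w j) => [[u pu]|] /=; last first.
  by split=> // -[x [[]]]; rewrite wj.
have su := succ_gt hm pu.
have [_ _ su_min] := T0_successor hm pu.
split=> [[x [[ux xmin]]]|[gu]].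
  rewrite E' => /eqP; rewrite subr_eq0 => /eqP gx.
  suff xE : x = Some (exist _ _ (psi_succ_Psi hm u)).
    by move: gx; rewrite xE cut_lam_succ // => /em_inj ->.
  move: ux xmin {gx}; rewrite /= wj; case: x => [[x px]|] /= ux xmin; last first.
    by case: (xmin (Some (exist _ _ (psi_succ_Psi hm u)))).
  apply: tval_inj => /=; congr Some; apply/eqP; rewrite eq_le.
  rewrite (su_min x px ux) andbT.
  have [//|sx] := T0_le_total hm x (s u).
  by case: (xmin (Some (exist _ _ (psi_succ_Psi hm u))) su).
exists (Some (exist _ _ (psi_succ_Psi hm u))); split; last first.
  by rewrite E' cut_lam_succ // gu subrr.
rewrite /= wj; split=> // -[[z pz]|] /= uz; last by move=> [].
rewrite /cut_lt /= => zs.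
by have := su_min z pz uz => /(lt_le_trans zs); rewrite ltxx.
Qed.

Lemma dfn_via_Psi (R : W -> T -> Prop) (R' : W -> W -> Prop) :
  (forall K J (i : K) (j : J), dfn (fun g w => R (g i) (w j))) ->
  (forall a b, R' a b <-> exists2 u, R a u & Some (b : G) = tval u) ->
  dfn2 R'.
Proof.
move=> dR RE K J i j.
have n1 : dfn (fun (g : K -> W) (w : option J -> T) =>
    R (g i) (w None) /\ Some (g j : G) = tval (w None)).
  by apply: nf_and; [exact: dR|exact: dfn_in_Psi].
apply: (nf_ext _ (dfn_exJ n1)) => g w v; rewrite RE.
by split=> [[x [h1 h2]]|[x h1 h2]]; exists x.
Qed.

Lemma dfn_psi : dfn2 (fun a b => psi_inf psi (Some (a : G)) = Some (b : G)).
Proof.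
apply: (dfn_via_Psi (R := fun a u => psi_inf psi (Some (a : G)) = tval u)).
  move=> K J i j.
  apply: (nf_ext _ (@nf_valE _ _ _ _ _ _ _ _ _ H K void J
    [:: (1, inl i)] (inl j))) => g w v.
  by rewrite lev_var; exact: cut_val_em.
move=> a b; split=> [h|[u -> ->]//].
have [u uE] : exists u : T, tval u = psi_inf psi (Some (a : G)).
  by exists (cut_val (em a)); apply/esym/cut_val_em.
by exists u; rewrite ?uE.
Qed.

Lemma dfn_succ : dfn2 (fun a b => succ_inf psi (Some (a : G)) = Some (b : G)).
Proof.
apply: (dfn_via_Psi (R := fun a u => Some (s a) = tval u)).
  move=> K J i j.
  apply: (nf_ext _ (@nf_valE _ _ _ _ _ _ _ _ _ H K void J
    [:: (1, inr None); (- 1, inl i)] (inl j))) => g w v.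
  rewrite !lev_cons lev_nil addr0 scale1r scaleN1r cut_val_omega_sub /=.
  split=> [<- //|h]; apply: tval_inj; exact: h.
move=> a b; split=> [h|[u uE ->]]; last by rewrite -uE.
by exists (Some (exist _ _ (psi_succ_Psi hm a))); rewrite //= -h.
Qed.

(** The graph of [p] is the converse of the graph of [s] restricted to arguments in Psi. *)
Lemma dfn_pred : dfn2 (fun a b => pred_inf psi (Some (a : G)) = Some (b : G)).
Proof.
move=> K J i j.
have n1 := nf_and (dfn_succ J j i) (dfn_exJ (dfn_in_Psi j None)).
apply: (nf_ext _ n1) => g w v; rewrite /pred_inf.
set A := (X in xget _ X).
have [_ inj _] := T0_bij hm.
have AE y : A y -> exists b, [/\ y = Some b, Psi psi b & s b = g i].
  by move=> [a [b [[aE] _ yE pb sb]]]; exists b; rewrite aE.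
split=> [[[sE] [x]]|h].
  rewrite /=; case: x => [[u pu]|] //= [gu].
  have Au : A (Some (g j)).
    exists (g i), (g j); split=> //; last by rewrite gu.
    by rewrite -sE; split; [exact: (psi_succ_Psi hm)|rewrite gu;
      exact: le_lt_trans (T0_s0_least hm pu) (succ_gt hm pu)].
  have [b [-> pb sb]] := AE _ (xgetI None Au).
  congr Some; apply: inj; rewrite ?inE //; first by rewrite gu.
  by rewrite sb.
have Ag : A (Some (g j)).
  have [eA|nA] := EM (exists y, A y); first by have := xgetPex None eA; rewrite h.
  have : xget None A = None by apply: xgetPN => y Ay; apply: nA; exists y.
  by rewrite h.
have [b [[gb] pb sb]] := AE _ Ag; split; first by rewrite /succ_inf /= gb sb.
by exists (Some (exist _ _ pb)); rewrite /= gb.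
Qed.

Lemma dfn_const K J (A : Prop) : dfn (fun (_ : K -> W) (_ : J -> T) => A).
Proof. exact: nf_const. Qed.

Lemma dfn_add K J (i j k : K) :
  dfn (fun g (w : J -> T) => g k = g i + g j :> W).
Proof.
pose t : form K := [:: (1, k); (- 1, i); (- 1, j)].
apply: (nf_ext _ (dfn_linear J t)) => g w v.
rewrite !lev_cons lev_nil addr0 scale1r !scaleN1r -opprD.
by split=> [/eqP|->]; rewrite ?subrr // subr_eq0 => /eqP.
Qed.

Lemma dfn_eq0 K J (k : K) : dfn (fun g (w : J -> T) => g k = 0 :> W).
Proof.
apply: (nf_ext _ (dfn_linear J [:: (1, k)])) => g w v.
by rewrite lev_var.
Qed.

(** * Translation of terms and formulas *)

Definition penv n (S : 'I_n -> bool) (g : 'I_n -> W) : 'I_n -> M :=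
  fun i => if S i then Some (g i : G) else None.

(** Normal forms know only finite elements, so there is one translation for each pattern [S] of
    finite variables. The extra variable [None] holds the value of the term when that is finite. *)
Definition term_dfn n (S : 'I_n -> bool) (t : term L n) : Prop :=
  dfn (fun (g : option 'I_n -> W) (w : void -> T) =>
    eval (penv S (fun i => g (Some i))) t = Some (g None : G)).

Lemma dfn_grename K K' J (a : K -> K') (P : (K -> W) -> (J -> T) -> Prop) :
  dfn P -> dfn (fun g w => P (fun k => g (a k)) w).
Proof. exact: (@nf_rename _ _ em _ _ lt None _ _ K void J K' void J a id id). Qed.

Lemma term_dfn_unary n (S : 'I_n -> bool) (t : term L n) (f : option G -> option G) :
  f None = None -> dfn2 (fun a b => f (Some (a : G)) = Some (b : G)) ->
  term_dfn S t ->
  dfn (fun (g : option 'I_n -> W) (w : void -> T) =>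
    f (eval (penv S (fun i => g (Some i))) t) = Some (g None : G)).
Proof.
move=> f0 df dt.
have n1 : dfn (fun (g : option (option 'I_n) -> W) (w : void -> T) =>
    eval (penv S (fun i => g (Some (Some i)))) t = Some (g None : G) /\
    f (Some (g None : G)) = Some (g (Some None) : G)).
  apply: nf_and; last exact: df.
  exact: (dfn_grename (omap Some) dt).
apply: (nf_ext _ (dfn_exW n1)) => g w v /=; split; first by move=> [y [-> ->]].
case E : (eval _ t) => [y|]; last by rewrite f0.
by move=> fy; exists y.
Qed.

Lemma term_dfnP n (S : 'I_n -> bool) (t : term L n) : term_dfn S t.
Proof.
elim: t => [i|f ts IH].
  rewrite /term_dfn /=; case Si : (S i); last first.
    by apply: (nf_ext _ (dfn_const _ _ False)) => g w v; rewrite /penv Si.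
  pose t : form (option 'I_n) := [:: (1, Some i); (- 1, None)].
  apply: (nf_ext _ (dfn_linear void t)) => g w v.
  rewrite !lev_cons lev_nil addr0 scale1r scaleN1r /penv Si.
  split=> [/eqP|[->]]; last by rewrite subrr.
  by rewrite subr_eq0 => /eqP ->.
case: f ts IH => [||||||| m] ts IH; rewrite /term_dfn /=.
- apply: (nf_ext _ (dfn_eq0 void None)) => g w v.
  by split=> [->|[<-]].
- have n1 : dfn (fun (g : option (option (option 'I_n)) -> W) (w : void -> T) =>
      (eval (penv S (fun i => g (Some (Some (Some i))))) (ts ord0) = Some (g None : G) /\
       eval (penv S (fun i => g (Some (Some (Some i))))) (ts ord_max) =
         Some (g (Some None) : G)) /\
      g (Some (Some None)) = g None + g (Some None)).
    apply: nf_and; last exact: dfn_add.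
    apply: nf_and; first exact: (dfn_grename (omap (fun i => Some (Some i))) (IH ord0)).
    pose a (o : option 'I_n) := if o is Some i then Some (Some (Some i)) else Some None.
    exact: (dfn_grename a (IH ord_max)).
  apply: (nf_ext _ (dfn_exW (dfn_exW n1))) => g w v /=; split.
    by move=> [y [z [[-> ->] gE]]]; rewrite gE.
  case E0 : (eval _ (ts ord0)) => [y|] //; case E1 : (eval _ (ts ord_max)) => [z|] //.
  by move=> [yz]; exists z, y; split.
- exact: (@term_dfn_unary _ _ _ (fun x => opp_inf x) erefl dfn_opp (IH ord0)).
- exact: (@term_dfn_unary _ _ _ (psi_inf psi) erefl dfn_psi (IH ord0)).
- by apply: (nf_ext _ (dfn_const _ _ False)) => g w v.
- exact: (@term_dfn_unary _ _ _ (succ_inf psi) erefl dfn_succ (IH ord0)).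
- apply: (@term_dfn_unary _ _ _ (pred_inf psi) _ dfn_pred (IH ord0)).
  by apply: xgetPN => y [a [b []]].
- exact: (@term_dfn_unary _ _ _ (fun x => div_inf m.+1 x) erefl (dfn_div m) (IH ord0)).
Qed.

(** The cases are which of the two terms is infinite. If exactly one is, the hypotheses make the
    truth of [R] independent of the finite argument, so each such case contributes a constant. *)
Lemma dfn_eval2 n (S : 'I_n -> bool) (t u : term L n)
    (R : option G -> option G -> Prop) :
  dfn2 (fun a b => R (Some (a : G)) (Some (b : G))) ->
  (forall x, R None (Some x) = R None (Some 0)) ->
  (forall x, R (Some x) None = R (Some 0) None) ->
  dfn (fun g (w : void -> T) => R (eval (penv S g) t) (eval (penv S g) u)).
Proof.
move=> dR RN NR.
have dt (v : term L n) : dfn (fun g (w : void -> T) =>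
    exists y : W, eval (penv S g) v = Some (y : G)).
  exact: (dfn_exW (term_dfnP S v)).
have n1 : dfn (fun (g : option (option 'I_n) -> W) (w : void -> T) =>
    (eval (penv S (fun i => g (Some (Some i)))) t = Some (g None : G) /\
     eval (penv S (fun i => g (Some (Some i)))) u = Some (g (Some None) : G)) /\
    R (Some (g None : G)) (Some (g (Some None) : G))).
  apply: nf_and; last exact: dR.
  apply: nf_and; first exact: (dfn_grename (omap Some) (term_dfnP S t)).
  exact: (dfn_grename Some (term_dfnP S u)).
have n2 := nf_and (nf_and (dt t) (nf_not (dt u))) (dfn_const _ _ (R (Some 0) None)).
have n3 := nf_and (nf_and (nf_not (dt t)) (dt u)) (dfn_const _ _ (R None (Some 0))).
have n4 := nf_and (nf_and (nf_not (dt t)) (nf_not (dt u))) (dfn_const _ _ (R None None)).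
apply: (nf_ext _ (nf_or (dfn_exW (dfn_exW n1)) (nf_or n2 (nf_or n3 n4)))) => g w v /=.
case: (eval _ t) => [x|]; case: (eval _ u) => [y|]; split.
- move=> [[y' [x' [[[->] [->]] //]]]|[[[_ nu] _]|[[[nt _] _]|[[nt _] _]]]].
  + by case: nu; exists y.
  + by case: nt; exists x.
  + by case: nt; exists x.
- by move=> Rxy; left; exists y, x.
- move=> [[y' [x' [[_] //]]]|[[_ h]|[[[nt _] _]|[[nt _] _]]]].
  + by rewrite NR.
  + by case: nt; exists x.
  + by case: nt; exists x.
- move=> h; right; left; split; last by rewrite -(NR x).
  by split; [exists x|move=> []].
- move=> [[y' [x' [[] //]]]|[[[[x' //]]]|[[_ h]|[[_ nu] _]]]].
  + by rewrite RN.
  + by case: nu; exists y.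
- move=> h; right; right; left; split; last by rewrite -(RN y).
  by split; [move=> []|exists y].
- by move=> [[y' [x' [[] //]]]|[[[[x' //]]]|[[[_ [x' //]]]|[_ h]]]].
- by move=> h; do 3 right; split=> //; split; move=> [].
Qed.

Lemma penv_cons n (S : 'I_n -> bool) g b (y : W) :
  penv (env_cons b S) (env_cons y g) =
  env_cons (if b then Some (y : G) else None : M) (penv S g).
Proof.
by apply/funext => i; rewrite /penv /env_cons; case: (unlift ord0 i).
Qed.

Lemma holds_dfn n (phi : formula L n) (S : 'I_n -> bool) :
  dfn (fun g (w : void -> T) => holds (M := M) phi (penv S g)).
Proof.
elim: phi S => {n} [n t u|n r ts|n phi IH|n phi IHphi chi IHchi|n phi IH] S /=.
- apply: (@dfn_eval2 n S t u (fun a b => a = b)).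
  + move=> K J i j; pose f : form K := [:: (1, i); (- 1, j)].
    apply: (nf_ext _ (dfn_linear J f)) => g w v.
    rewrite !lev_cons lev_nil addr0 scale1r scaleN1r.
    by split=> [/eqP|[->]]; rewrite ?subrr // subr_eq0 => /eqP ->.
  + by move=> x; apply/propext.
  + by move=> x; apply/propext.
- by apply: (@dfn_eval2 n S (ts ord0) (ts ord_max) (@lt_inf G)) => //; exact: dfn_lt.
- exact: (nf_not (IH S)).
- exact: (nf_and (IHphi S) (IHchi S)).
- have n1 : dfn (fun (g : 'I_n -> W) (w : void -> T) =>
      exists y : W, holds (M := M) phi (penv (env_cons true S) (env_cons y g))).
    exact: (dfn_exW (dfn_grename (unlift ord0) (IH (env_cons true S)))).
  (* The quantifier also covers infinity. In that case the bound variable is marked infinite in [S],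
     and its coordinate, no longer read, is filled with the empty form. *)
  pose z (i : 'I_n.+1) : form ('I_n + option void) :=
    if unlift ord0 i is Some j then [:: (1, inl j)] else [::].
  have [Q nQ QE] := nf_subst (IH (env_cons false S)) z id (@id void).
  apply: (nf_ext _ (nf_or n1 nQ)) => g w v.
  have <- := QE (env_cons 0 g) g w v; last first.
    move=> i; rewrite /env_cons /z; case: (unlift ord0 i) => [j|].
      by rewrite lev_var.
    by rewrite lev_nil linear0.
  rewrite penv_cons; split=> [[[y]|h]|[[y|] h]].
  + by rewrite penv_cons => h; exists (Some y).
  + by exists None.
  + by left; exists y; rewrite penv_cons.
  + by right.
Qed.

(** * Order formulas expressed in the language *)

Fixpoint tlift n (t : term L n) : term L n.+1 :=
  match t with
  | Var i => Var L (lift ord0 i)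
  | App f ts => App (fun j => tlift (ts j))
  end.

Lemma eval_tlift n (t : term L n) (x : M) (e : 'I_n -> M) :
  eval (env_cons x e) (tlift t) = eval e t.
Proof.
elim: t => [i|f ts IH] /=; first by rewrite /env_cons liftK.
have -> // : (fun j => eval (env_cons x e) (tlift (ts j))) = (fun j => eval e (ts j)).
by apply/funext => j; exact: IH.
Qed.

Definition inf_term n : term L n :=
  @App L n FInfty (fun i : 'I_0 => False_rect _ (notF (ltn_ord i))).

Definition fun1 n (f : log_func) (t : term L n) : term L n :=
  @App L n f (fun=> t).

(** The function [psi], extended to infinity, has range Psi together with infinity, which is the
    image of [T] under [tval]; quantifiers over [T] are relativised to it. *)
Definition var_in_range_psi n (i : 'I_n) : formula L n :=
  Ex (Equal (fun1 FPsi (Var L ord0)) (Var L (lift ord0 i))).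

Lemma holds_var_in_range_psi n (i : 'I_n) (e : 'I_n -> M) :
  holds (var_in_range_psi i) e <-> exists t : T, e i = tval t.
Proof.
rewrite /= /env_cons unlift_none liftK; split=> [[[x|] h]|[t tE]].
- by exists (cut_val (em x)); rewrite -h; apply/cut_val_em.
- by exists None.
- case: t tE => [[u pu]|] tE; last by exists None.
  have [y y0 yE] := pu; exists (Some y).
  by rewrite tE /= (negbTE y0) yE.
Qed.

(** Order variables are interpreted by terms and not just by variables, because the values needed
    later are successors of variables, parameters and infinity. *)
Lemma odef_formula I (R : (I -> T) -> Prop) : odef lt R ->
  forall n (f : I -> term L n), exists phi : formula L n,
  forall (e : 'I_n -> M) (u : I -> T), (forall i, eval e (f i) = tval (u i)) ->
    R u <-> holds phi e.
Proof.
elim=> {I R} [I i j|I P _ IH|I P Q _ IHP _ IHQ|I P _ IH] n f.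
- exists (@Rel L n RLt (fun k => if k == ord0 then f i else f j)) => e u uE /=.
  by rewrite !uE.
- have [phi phiE] := IH n f; exists (Not phi) => e u uE /=.
  by rewrite (propext (phiE e u uE)).
- have [phi phiE] := IHP n f; have [chi chiE] := IHQ n f.
  exists (And phi chi) => e u uE /=.
  by rewrite (propext (phiE e u uE)) (propext (chiE e u uE)).
- pose f' (i : option I) : term L n.+1 :=
    if i is Some j then tlift (f j) else Var L ord0.
  have [phi phiE] := IH n.+1 f'.
  exists (Ex (And (var_in_range_psi ord0) phi)) => e u uE.
  have key t : P (ocons t u) <-> holds phi (env_cons (tval t : M) e).
    apply: phiE => -[i|] /=; first by rewrite eval_tlift.
    by rewrite /env_cons unlift_none.
  split=> [[t Pt]|[x [/holds_var_in_range_psi[t]]]].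
    exists (tval t); split; last exact/key.
    by apply/holds_var_in_range_psi; exists t; rewrite /env_cons unlift_none.
  by rewrite /env_cons unlift_none => -> /key Pt; exists t.
Qed.

Definition var_in_Psi n (i : 'I_n) : formula L n :=
  And (var_in_range_psi i)
      (Not (Equal (Var L i) (inf_term n))).

Lemma holds_var_in_Psi n (i : 'I_n) (e : 'I_n -> M) :
  holds (var_in_Psi i) e <-> Psi_inf psi (e i).
Proof.
split=> [[/holds_var_in_range_psi[[[x px]|] xE]] /=|[x px xE]].
- by move=> _; exists x; rewrite ?xE.
- by rewrite xE.
- split; last by rewrite /= -xE.
  by apply/holds_var_in_range_psi; exists (Some (exist _ _ px)); rewrite -xE.
Qed.

Lemma formula_allIn n A (F : A -> formula L n) (l : seq A) : exists phi : formula L n,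
  forall e : 'I_n -> M, holds phi e <-> forall a, List.In a l -> holds (F a) e.
Proof.
elim: l => [|a l [phi phiE]].
  by exists (Equal (inf_term n) (inf_term n)).
exists (And (F a) phi) => e /=; rewrite (propext (phiE e)); split.
  by move=> [Fa Fl] b [<-|/Fl].
by move=> h; split=> [|b bl]; apply: h; [left|right].
Qed.

Lemma mem_In (A : eqType) (a : A) (l : seq A) : a \in l -> List.In a l.
Proof.
by elim: l => //= b l IH; rewrite in_cons => /predU1P[->|/IH]; [left|right].
Qed.

(** * Traces of definable sets on Psi *)

Lemma env_cat_lshift n m (x : 'I_n -> M) (c : 'I_m -> M) (i : 'I_n) :
  env_cat x c (lshift m i) = x i.
Proof. by rewrite /env_cat -[lshift m i]/(unsplit (inl i)) unsplitK. Qed.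

Lemma env_cat_rshift n m (x : 'I_n -> M) (c : 'I_m -> M) (k : 'I_m) :
  env_cat x c (rshift n k) = c k.
Proof. by rewrite /env_cat -[rshift n k]/(unsplit (inr k)) unsplitK. Qed.

Lemma Psi_definable :
  definable_over set0 [set x : 'I_1 -> M | Psi_inf psi (x ord0)]%classic.
Proof.
exists 0%N, (var_in_Psi (lshift 0 ord0)), (fun=> None); split=> [[]//|x].
by rewrite (propext (holds_var_in_Psi _ _)) env_cat_lshift.
Qed.

(* An element x of Psi is lam (s x), so it can be moved from the Gamma-variables
   to the Psi-variables. *)
Lemma Psi_trace_odef n m (phi : formula L (n + m)) (c : 'I_m -> M) :
  exists m' (c' : 'I_m' -> T) (R : ('I_m' + 'I_n -> T) -> Prop), odef lt R /\
  forall (y : 'I_n -> G) (py : forall j, Psi psi (y j)),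
    holds phi (env_cat (fun j => Some (y j) : M) c) <->
    R (senv c' (fun j => Some (exist _ _ (psi_succ_Psi hm (y j))))).
Proof.
pose S (i : 'I_(n + m)) := if fintype.split i is inr k then isSome (c k) else true.
(* The first [n] variables are read as [lam] of values, while the parameters stay vectors; an
   infinite parameter is marked in [S] and gets the vector 0. *)
pose z (i : 'I_(n + m)) : form ('I_m + option 'I_n) :=
  match fintype.split i with
  | inl j => [:: (1, inr (Some j))]
  | inr k => [:: (1, inl k)]
  end.
have [Q nQ QE] := nf_subst (holds_dfn phi S) z (@of_void 'I_n) (@id void).
pose g' (k : 'I_m) : W := odflt 0 (c k).
(* Every index in ['I_n] is demoted, so the initial values are irrelevant and are set to [None]. The
   parameters [c1] consist of these and of the values found along the branch that [g'] selects. *)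
have [m' [c1 [R [oR RE]]]] := nf_params (nf_demote_seq H (enum 'I_n) nQ) g'
  (f := id) (c := fun=> None) (fun=> erefl).
pose h (i : 'I_m' + (void + 'I_n)) : 'I_m' + 'I_n :=
  match i with inl k => inl k | inr (inl v) => of_void _ v | inr (inr j) => inr j end.
exists m', c1, (fun e => R (fun i => e (h i))); split; first exact: odef_sub.
move=> y py; set w : 'I_n -> T := fun j => Some _.
pose v : void + 'I_n -> T := senv (@of_void T) w.
have -> : (fun i => senv c1 w (h i)) = senv c1 v.
  by apply/funext => -[k|[[]|j]].
rewrite -(propext (RE v)).
have -> : (fun j => if j \in enum 'I_n then v (inr j) else None) = w.
  by apply/funext => j; rewrite mem_enum.
pose g (i : 'I_(n + m)) : W :=
  match fintype.split i with inl j => y j | inr k => g' k end.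
have <- := QE g g' w (fun i => v (inl i)).
  have -> // : env_cat (fun j => Some (y j) : M) c = penv S g.
  apply/funext => i; rewrite /env_cat /penv /S /g /g'.
  by case: (fintype.split i) => // k; case: (c k).
move=> i; rewrite /g /z; case: (fintype.split i) => j; rewrite lev_var //.
exact/esym/(cut_lam_succ (py j)).
Qed.

Lemma Psi_stably_embedded : stably_embedded (Psi_inf psi).
Proof.
split; first exact: Psi_definable.
move=> n X _ XPsi [m [phi [c [_ XE]]]].
have [m' [c' [R [oR RE]]]] := Psi_trace_odef phi c.
(* The values attached to the tuple are the successors of its entries. A parameter with value [None]
   is not in Psi and is expressed by the constant for infinity. *)
pose f (i : 'I_m' + 'I_n) : term L (n + m') :=
  match i with
  | inl k => if c' k is Some _ then Var L (rshift n k) else inf_term _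
  | inr j => fun1 FSucc (Var L (lshift m' j))
  end.
have [chi chiE] := odef_formula oR f.
have [dom domE] := formula_allIn (fun j : 'I_n => var_in_Psi (lshift m' j)) (enum 'I_n).
(* The slots of infinite parameters are padded with [s 0], so that all parameters lie in Psi; [f]
   does not refer to these slots. *)
pose c2 (k : 'I_m') : M := odflt (Some (s 0)) (omap (fun u => Some (sval u)) (c' k)).
exists m', (And dom chi), c2; split.
  move=> k; rewrite /c2; case: (c' k) => [[u pu]|] /=; first by exists u.
  by exists (s 0) => //; exact: (T0_s0_in hm).
move=> x.
have xdom : holds dom (env_cat x c2) <-> forall j, Psi_inf psi (x j).
  rewrite (propext (domE _)); split=> hx j.
    have /hx : List.In j (enum 'I_n).
      by apply: mem_In; rewrite mem_enum.
    by rewrite (propext (holds_var_in_Psi _ _)) env_cat_lshift.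
  by move=> _; rewrite (propext (holds_var_in_Psi _ _)) env_cat_lshift.
have key : (forall j, Psi_inf psi (x j)) -> X x <-> holds chi (env_cat x c2).
  move=> px; have [y yE] : exists y : 'I_n -> G,
      forall j, Psi psi (y j) /\ Some (y j) = x j.
    have ex j : exists z, Psi psi z /\ Some z = x j.
      by have [z pz zx] := px j; exists z.
    by exists (fun j => sval (cid (ex j))) => j; case: cid.
  have -> : x = (fun j => Some (y j) : M) by apply/funext => j; case: (yE j).
  rewrite (propext (XE _)) (propext (RE y (fun j => proj1 (yE j)))).
  apply: chiE => -[k|j] /=.
    rewrite /c2; case ck : (c' k) => [u|] //=.
    by rewrite env_cat_rshift ck.
  by rewrite env_cat_lshift.
split=> [Xx|[/xdom px]]; last exact: (iffRL (key px)).
have px := XPsi x Xx.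
by split; [exact/xdom|exact/(key px)].
Qed.

End Translation.

Theorem corollary7p2 (G : porderZmodType) (psi : G -> G)
    (hmodel : T0_model psi) :
  stably_embedded (Psi_inf psi).
Proof. exact: Psi_stably_embedded hmodel. Qed.
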